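(* The censored Hill estimator $\gamma_n=\int_1^\infty\log(t)\,dF_{k,n}(t)$ satisfies $\gamma_n\xrightarrow{\mathbb{P}}\gamma_X$ as $n\to\infty$.
   Context: Setting. $\{X_i\}_{i\ge1}$ and $\{Y_i\}_{i\ge1}$ are independent i.i.d. sequences with distribution functions $F_X,F_Y$. For $i\in\{X,Y\}$, $1-F_i(x)=L_i(x)x^{-1/\gamma_i}$ with $\gamma_i>0$ and $L_i$ slowly varying at infinity ($L_i(tx)/L_i(t)\to1$ as $t\to\infty$ for every $x>0$). One observes $Z_i=\min\{X_i,Y_i\}$ and $\delta_i=I(X_i\le Y_i)$, $i=1,\dots,n$. $F_Z$ is the distribution function of $Z_1$, and $Z_{1,n}\le\dots\le Z_{n,n}$ are the order statistics. Put $\gamma=\frac{\gamma_X\gamma_Y}{\gamma_X+\gamma_Y}$, $p=\frac{\gamma_Y}{\gamma_X+\gamma_Y}$. Let $k=k_n$ be an integer sequence with $k\to\infty$, $k/n\to0$, and $u_n=F_Z^{\leftarrow}(1-k/n)$ with $n(1-F_Z(u_n))=k$. Standing assumption (Condition 1). With $p(s)=\mathbb{P}(\delta_1=1\mid Z_1>s)$: $\sqrt{k}(p(u_n)-p)\to0$, and for every $[a,b]\subset(0,\infty)$, $$\limsup_{n\to\infty}\sqrt{k}\sup_{a\le s\le t<b}\Big|\frac{\mathbb{P}(u_ns<Z_1\le u_nt,\ \delta_1=1)}{1-F_Z(u_n)}-p\,(s^{-1/\gamma}-t^{-1/\gamma})\Big|=0.$$ Notation. For $s>0$, $\widehat T_n(s)=\frac1k\sum_{i=1}^nI(Z_i>Z_{n-k,n}s)$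 and $\widehat T^1_n(s)=\frac1k\sum_{i=1}^nI(Z_i>Z_{n-k,n}s,\ \delta_i=1)$. The Extreme Nelson–Aalen and Extreme Kaplan–Meier estimators are, for $t\ge1$, $$\Lambda_{k,n}(t)=-\int_{(1,t]}\frac{1}{\widehat T_n(s-)}\,d\widehat T^1_n(s),\qquad F_{k,n}(t)=1-\prod_{1<s\le t}\big(1-\Delta\Lambda_{k,n}(s)\big),$$ the product being over the (finitely many) jump points of $\Lambda_{k,n}$ (product integral). They are considered on the event $\{Z_{n-k,n}>0\}$, whose probability tends to one. $F_{k,n}$ is a step function with finitely many jumps, so $\gamma_n$ is a finite sum (the total mass of $F_{k,n}$ may be less than $1$). *)

(* Defs.v *)
From HB Require Import structures.
From mathcomp Require Import all_boot all_order all_algebra finmap.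
From mathcomp Require Import all_classical all_reals all_analysis.
From mathcomp Require Import measurable_realfun.

Set Implicit Arguments.
Unset Strict Implicit.
Unset Printing Implicit Defensive.

Import Order.TTheory GRing.Theory Num.Theory.
Import numFieldNormedType.Exports.

Local Open Scope classical_set_scope.
Local Open Scope ring_scope.

(* Sequences are indexed from 0, so that [X i] stands for X_{i+1}; in particular
   [Z 0] is Z_1 and a sample of size n is indexed by i < n. *)

Section general.
Context {R : realType} {d : measure_display} {T : measurableType d}.
Implicit Type P : probability T R.

Definition mutually_independent P (I : choiceType) (W : I -> {RV P >-> R}) :=
  forall (J : {fset I}) (B : I -> set R), (forall i, measurable (B i)) ->
    P (\bigcap_(i in [set` J]) (W i @^-1` B i)) =
    (\prod_(i <- J) P (W i @^-1` B i))%E.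

Definition cvg_in_probability P (W : nat -> T -> R) (V : T -> R) :=
  forall eps : R, 0 < eps ->
    P [set w | eps <= `|W n w - V w|] @[n --> \oo] --> 0%E.

Definition slowly_varying (L : R -> R) :=
  forall x, 0 < x -> L (t * x) / L t @[t --> +oo] --> (1 : R).

(* F^{<-}(y), used only for 0 < y < 1 *)
Definition left_inverse (F : R -> R) (y : R) : R := inf [set x | y <= F x].

Definition left_limit (f : R -> R) (s : R) : R := lim (f x @[x --> s^'-]).

Definition jump (f : R -> R) (s : R) : R := f s - left_limit f s.

(* Stieltjes integral of g over D with respect to df, for f a right-continuous
   step function with finitely many jumps in D. *)
Definition step_integral (D : set R) (g f : R -> R) : R :=
  \sum_(s \in D) g s * jump f s.

(* Product integral of 1 - df over D, for f as above: points at which the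
   factor is 1 are discarded by [\big[_/_]_(_ \in _)], so the product ranges
   over the jump points of f in D. *)
Definition step_product_integral (D : set R) (f : R -> R) : R :=
  \big[*%R/1]_(s \in D) (1 - jump f s).

End general.

Section censoring.
Context {R : realType} {d : measure_display} {T : measurableType d}
  {P : probability T R}.
Variables X Y : nat -> {RV P >-> R}.

Definition XY_family (j : nat + nat) : {RV P >-> R} :=
  match j with inl i => X i | inr i => Y i end.

Definition Z (i : nat) : {RV P >-> R} := X i \min Y i.

Definition delta (i : nat) (w : T) : bool := X i w <= Y i w.

Definition FZ (x : R) : R := fine (cdf (Z 0%N) x).

(* P(delta_1 = 1 | Z_1 > s) *)
Definition prob_uncensored (s : R) : R :=
  fine (P [set w | s < Z 0 w /\ delta 0 w]) / fine (P [set w | s < Z 0 w]).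

(* The order statistic Z_{j,n} (1 <= j <= n), with Z_{1,n} the smallest. *)
Definition order_stat (n j : nat) (w : T) : R :=
  nth 0 (sort <=%R [seq Z i w | i <- iota 0 n]) j.-1.

Variable k : nat -> nat.

Definition u (n : nat) : R := left_inverse FZ (1 - (k n)%:R / n%:R).

Definition tail_discrepancy (p gamma : R) (n : nat) (s t : R) : R :=
  `| fine (P [set w | u n * s < Z 0 w <= u n * t /\ delta 0 w])
       / (1 - FZ (u n))
     - p * (s `^ (- gamma^-1) - t `^ (- gamma^-1)) |.

Definition condition1 (p gamma : R) :=
  (Num.sqrt (k n)%:R * (prob_uncensored (u n) - p) @[n --> \oo] --> (0 : R)) /\
  forall a b : R, 0 < a -> a < b ->
    limn_esup (fun n => (Num.sqrt (k n)%:R)%:E *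
      ereal_sup [set x | exists s t, [/\ (a <= s)%R, (s <= t)%R, (t < b)%R
                           & x = (tail_discrepancy p gamma n s t)%:E]])%E
    = 0%E.

(* The estimators are meaningful for 0 < k n < n on the event
   Z_{n-k,n} > 0, whose probability tends to 1; elsewhere they take an
   irrelevant real value. *)
Section estimators.
Variables (n : nat) (w : T).

Definition T_hat (s : R) : R :=
  (k n)%:R^-1 * \sum_(i < n) (order_stat n (n - k n) w * s < Z i w)%R%:R.

Definition T1_hat (s : R) : R :=
  (k n)%:R^-1 *
    \sum_(i < n) ((order_stat n (n - k n) w * s < Z i w)%R && delta i w)%:R.

Definition nelson_aalen (t : R) : R :=
  - step_integral `]1, t] (fun s => (left_limit T_hat s)^-1) T1_hat.

Definition kaplan_meier (t : R) : R :=
  1 - step_product_integral `]1, t] nelson_aalen.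

Definition censored_hill : R :=
  step_integral `[1, +oo[ (fun t => ln t) kaplan_meier.

End estimators.
End censoring.

(* Main.v *)
(* The counts of the pairs (X_i, Y_i) in finitely many rectangles determine the
   censored Hill estimator up to a small error, and they are controlled by
   Chebyshev's inequality.  Take the deterministic grid y_i = u_n e^{h(i-1)} with a
   small fixed mesh h, and let N_i be the number of Z's beyond y_i and D_i the number
   of uncensored Z's in (y_i, y_{i+1}].  The product-limit survival function is
   multiplied over (y_i, y_{i+1}] by a factor between 1 - D_i / N_{i+1} and
   1 / (1 + D_i / N_i).  By regular variation and the independence of X and Y, both
   ratios are eventually close to h / gammaX: if h is small, D_i is caught between the
   counts of the rectangles X in (y_i, y_{i+1}], Y > y_{i+1}, resp. Y > y_i.  The
   Hill estimator is, up to O(h), h times the sum over i of the survival function at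
   y_i, hence close to h / (h / gammaX) = gammaX.

   The grid is followed over J ~ log k blocks, far enough for the survival function
   to be at most (1 + c)^{-J}, which beats the logarithm of the largest observation,
   but not so far that the expected counts n P(Z > y_i) fail to dominate J.
   The random threshold Z_{n-k,n} lies between y_0 and y_2 with high probability. *)

Require Import Defs.
From HB Require Import structures.
From mathcomp Require Import all_boot all_order all_algebra finmap.
From mathcomp Require Import all_classical all_reals all_analysis.
From mathcomp Require Import measurable_realfun.
From mathcomp Require Import ring lra.

Set Implicit Arguments.
Unset Strict Implicit.
Unset Printing Implicit Defensive.

Import Order.TTheory GRing.Theory Num.Theory.
Import numFieldNormedType.Exports.

Local Open Scope classical_set_scope.
Local Open Scope ring_scope.

(** * Product-limit sums *)

Section product_limit.
Context {R : realFieldType}.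
Implicit Types (r s : seq R) (l : R -> R).

(** The sum telescopes along the sorted list: the term at [x] is the drop of the partial product at
    [x]. Uniqueness matters because the inner product runs over strictly smaller points. *)
Lemma product_limit_mass s l : uniq s ->
  \sum_(x <- s) (\prod_(y <- s | y < x) (1 - l y)) * l x =
  1 - \prod_(y <- s) (1 - l y).
Proof.
move=> us.
have us' : uniq (sort <=%R s) by rewrite sort_uniq.
have ps : perm_eq s (sort <=%R s) by rewrite perm_sym perm_sort.
rewrite (perm_big _ ps) [in RHS](perm_big _ ps)/=.
under eq_bigr do rewrite (perm_big _ ps)/=.
have : sorted <%R (sort <=%R s) by rewrite lt_sorted_uniq_le us' sort_le_sorted.
elim: (sort <=%R s) => [_|a t IH]; first by rewrite !big_nil subrr.
rewrite /= (path_sortedE lt_trans) => /andP[/allP at_ st].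
rewrite !big_cons ltxx big_seq_cond big_pred0; last first.
  by move=> y; apply/negP => /andP[/at_/lt_trans h /h]; rewrite ltxx.
rewrite mul1r.
have -> : \sum_(x <- t) \prod_(y <- a :: t | y < x) (1 - l y) * l x =
  (1 - l a) * \sum_(x <- t) \prod_(y <- t | y < x) (1 - l y) * l x.
  rewrite big_distrr/= big_seq [RHS]big_seq; apply: eq_bigr => x /at_ ax.
  by rewrite big_cons ax mulrA.
by rewrite IH//; ring.
Qed.

Lemma product_limit_mass_le r l (a b : R) : uniq r ->
  \sum_(x <- r | a < x <= b) (\prod_(y <- r | a < y < x) (1 - l y)) * l x =
  1 - \prod_(y <- r | a < y <= b) (1 - l y).
Proof.
move=> ur; have := @product_limit_mass [seq x <- r | a < x <= b] l.
rewrite filter_uniq// !big_filter => <-//.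
apply: eq_bigr => x /andP[ax xb]; rewrite big_filter_cond; congr (_ * _).
apply: eq_bigl => y; case: (ltP a y) => //= ay; case: (ltP y x) => //= yx.
  by rewrite (le_trans (ltW yx)).
by rewrite andbF.
Qed.

(** Both products are one minus the mass up to some point, so their difference is the mass beyond
    [a]. *)
Lemma product_limit_mass_gt r l (U a : R) : uniq r -> U <= a ->
  (forall x, 0 <= l x <= 1) ->
  \prod_(y <- r | U < y <= a) (1 - l y) - \prod_(y <- r | U < y) (1 - l y) =
  \sum_(x <- r | U < x) (\prod_(y <- r | U < y < x) (1 - l y)) * l x * (a < x)%R%:R.
Proof.
move=> ur Ua l01.
(* [b] bounds every point of [r], which turns the half-line into an interval covered by
   [product_limit_mass_le]. *)
pose b := \big[Order.max/a]_(x <- r) x.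
have rb x : x \in r -> x <= b by move=> xr; apply: le_bigmax_seq.
have key (Q : pred R) (G : R -> R) op idx :
    \big[op/idx]_(y <- r | Q y) G y = \big[op/idx]_(y <- r | Q y && (y <= b)) G y.
  rewrite big_seq_cond [RHS]big_seq_cond; apply: eq_bigl => y.
  by case: (boolP (y \in r)) => //= /rb ->; rewrite andbT.
have -> : \prod_(y <- r | U < y) (1 - l y) = \prod_(y <- r | U < y <= b) (1 - l y).
  exact: key.
have := product_limit_mass_le l U b ur; have := product_limit_mass_le l U a ur.
set S1 := \sum_(_ <- _ | _) _; set S2 := \sum_(_ <- _ | _) _ => e1 e2.
have -> : \prod_(y <- r | U < y <= a) (1 - l y) -
  \prod_(y <- r | U < y <= b) (1 - l y) = S2 - S1 by rewrite e1 e2; ring.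
rewrite (key _ _ +%R) /S2 (bigID (fun x => x <= a))/=.
have -> : S1 = \sum_(i <- r | (U < i <= b) && (i <= a))
   \prod_(y <- r | U < y < i) (1 - l y) * l i.
  rewrite /S1 (key _ _ +%R); apply: eq_bigl => i.
  by rewrite -!andbA [(i <= a) && _]andbC.
rewrite addrAC subrr add0r [LHS]big_mkcond [RHS]big_mkcond/=.
apply: eq_bigr => x _; rewrite -ltNge.
by case: (U < x <= b); case: (a < x); rewrite /= ?mulr1 ?mulr0.
Qed.

(** Weierstrass product inequality, by peeling off one factor. *)
Lemma prod1B_ge r (P : pred R) l : (forall x, 0 <= l x <= 1) ->
  1 - \sum_(y <- r | P y) l y <= \prod_(y <- r | P y) (1 - l y).
Proof.
move=> l01; elim: r => [|a r IH]; first by rewrite !big_nil subr0.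
rewrite !big_cons; case: ifP => // _.
have /andP[l0 l1] := l01 a.
have S0 : 0 <= \sum_(y <- r | P y) l y by apply: sumr_ge0 => i _; case/andP: (l01 i).
nra.
Qed.

(** A new factor does not increase the product times one plus the sum:
    [(1 - l a) * (1 + (l a + q)) <= 1 + q] for nonnegative [l a] and [q]. *)
Lemma prod1B_le r (P : pred R) l : (forall x, 0 <= l x <= 1) ->
  \prod_(y <- r | P y) (1 - l y) <= (1 + \sum_(y <- r | P y) l y)^-1.
Proof.
move=> l01.
have S0 r' : 0 <= \sum_(y <- r' | P y) l y.
  by apply: sumr_ge0 => i _; case/andP: (l01 i).
rewrite -[leRHS]div1r ler_pdivlMr ?ltr_wpDr//.
elim: r => [|a r IH]; first by rewrite !big_nil addr0 mulr1.
rewrite !big_cons; case: ifP => // _.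
have /andP[l0 l1] := l01 a.
have := S0 r.
have : 0 <= \prod_(y <- r | P y) (1 - l y).
  by apply: prodr_ge0 => i _; case/andP: (l01 i) => _ ?; rewrite subr_ge0.
move: IH; set p := \prod_(_ <- _ | _) _; set q := \sum_(_ <- _ | _) _ => IH p0 q0.
suff : p * ((1 - l a) * (1 + (l a + q))) <= p * (1 + q) by lra.
apply: ler_wpM2l => //; nra.
Qed.

Lemma prod1B_ge0 r (P : pred R) l : (forall x, 0 <= l x <= 1) ->
  0 <= \prod_(y <- r | P y) (1 - l y).
Proof.
by move=> l01; apply: prodr_ge0 => i _; case/andP: (l01 i) => _ ?; rewrite subr_ge0.
Qed.

Lemma prod1B_le1 r (P : pred R) l : (forall x, 0 <= l x <= 1) ->
  \prod_(y <- r | P y) (1 - l y) <= 1.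
Proof.
move=> l01; apply: prodr_ile1 => i _; case/andP: (l01 i) => ? ?.
by rewrite subr_ge0 gerBl; apply/andP.
Qed.

Lemma prod_oc_split r l (a b c : R) : a <= b -> b <= c ->
  \prod_(y <- r | a < y <= c) (1 - l y) =
  \prod_(y <- r | a < y <= b) (1 - l y) * \prod_(y <- r | b < y <= c) (1 - l y).
Proof.
move=> ab bc; rewrite (bigID (fun x => x <= b))/=; congr (_ * _); apply: eq_bigl => x.
  by case: (ltP a x) => //= ax; case: (leP x b) => xb; rewrite ?andbF// (le_trans xb).
by case: (leP x b) => xb; rewrite ?andbF ?andbT//= (le_lt_trans ab xb).
Qed.

End product_limit.

(** * Bounds on a geometric grid *)

Section sample.
Context {R : realType} (z : nat -> R) (e : nat -> bool) (n : nat).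
Implicit Types a b U x y : R.

Definition at_risk x : R := \sum_(i < n) (x <= z i)%R%:R.
Definition exceedances x : R := \sum_(i < n) (x < z i)%R%:R.
Definition uncensored x : R := \sum_(i < n) ((z i == x) && e i)%:R.
Definition uncensored_in a b : R := \sum_(i < n) ((a < z i <= b)%R && e i)%:R.
(** The Nelson-Aalen increment at level [x], ties included; it is 0 when nothing is at risk, as
    division by zero yields 0. *)
Definition hazard x : R := uncensored x / at_risk x.
(** Duplicates are removed because [uncensored] and [at_risk] already count ties with
    multiplicity. *)
Definition observations : seq R := undup [seq z i | i <- iota 0 n].

(** The censored Hill estimator for a positive threshold [U], on the unscaled observations: the
    weight of [ln (x / U)] is the Kaplan-Meier jump at [x / U]. *)
Definition hill_sum U : R :=
  \sum_(x <- observations | U < x)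
    ln (x / U) * (\prod_(y <- observations | U < y < x) (1 - hazard y) * hazard x).

Lemma observationsP x : x \in observations -> exists2 i, (i < n)%N & x = z i.
Proof.
by rewrite mem_undup => /mapP[i]; rewrite mem_iota => ? ->; exists i.
Qed.

Lemma mem_observations i : (i < n)%N -> z i \in observations.
Proof. by move=> ni; rewrite mem_undup; apply/mapP; exists i; rewrite ?mem_iota. Qed.

Lemma at_risk_ge0 x : 0 <= at_risk x.
Proof. by apply: sumr_ge0 => i _; exact: ler0n. Qed.

Lemma hazard01 x : 0 <= hazard x <= 1.
Proof.
have d0 : 0 <= uncensored x by apply: sumr_ge0 => i _; exact: ler0n.
have := at_risk_ge0 x; rewrite le_eqVlt => /predU1P[r0|r0].
  by rewrite /hazard -r0 invr0 mulr0 lexx ler01.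
rewrite divr_ge0 ?(ltW r0)//= ler_pdivrMr// mul1r ler_sum// => i _.
by rewrite ler_nat; case: eqP => //= ->; rewrite lexx; case: (e i).
Qed.

Lemma sum_uncensored a b :
  \sum_(y <- observations | a < y <= b) uncensored y = uncensored_in a b.
Proof.
rewrite exchange_big/=; apply: eq_bigr => i _; rewrite big_mkcond/=.
rewrite (bigD1_seq (z i)) ?mem_observations ?undup_uniq//= eqxx/= big1 ?addr0.
  by case: (a < z i <= b).
by move=> y; rewrite eq_sym => /negPf ->; case: ifP.
Qed.

(** At a point [y > a] at most [exceedances a] observations are at risk, so the hazards in the block
    add up to at least [c]. *)
Lemma product_block_le a b c : 0 <= c -> 0 < exceedances a ->
  c * exceedances a <= uncensored_in a b ->
  \prod_(y <- observations | a < y <= b) (1 - hazard y) <= (1 + c)^-1.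
Proof.
move=> c0 N0 cN; apply: le_trans (prod1B_le _ _ hazard01) _.
have S0 : c <= \sum_(y <- observations | a < y <= b) hazard y.
  apply: (@le_trans _ _ (uncensored_in a b / exceedances a)).
    by rewrite ler_pdivlMr.
  rewrite -sum_uncensored mulr_suml big_seq_cond [leRHS]big_seq_cond.
  apply: ler_sum => y /andP[/observationsP[i ni yi] /andP[ay yb]].
  apply: ler_wpM2l; first by apply: sumr_ge0 => j _; exact: ler0n.
  have r0 : 0 < at_risk y.
    rewrite /at_risk (bigD1 (Ordinal ni))//= -yi lexx ltr_pwDl//.
    by apply: sumr_ge0 => j _; exact: ler0n.
  rewrite lef_pV2// ler_sum// => j _; rewrite ler_nat.
  by case: (leP y (z j)) => // yz; rewrite (lt_le_trans ay yz).
by rewrite lef_pV2 ?posrE; lra.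
Qed.

(** At a point [y <= b] at least [exceedances b] observations are at risk, so the hazards in the
    block add up to at most [c]. *)
Lemma product_block_ge a b c : 0 < exceedances b ->
  uncensored_in a b <= c * exceedances b ->
  1 - c <= \prod_(y <- observations | a < y <= b) (1 - hazard y).
Proof.
move=> N0 cN; apply: le_trans (prod1B_ge _ _ hazard01).
rewrite lerB//; apply: (@le_trans _ _ (uncensored_in a b / exceedances b)).
  rewrite -sum_uncensored mulr_suml.
  apply: ler_sum => y /andP[ay yb].
  apply: ler_wpM2l; first by apply: sumr_ge0 => j _; exact: ler0n.
  have h : exceedances b <= at_risk y.
    rewrite ler_sum// => j _; rewrite ler_nat.
    by case: (ltP b (z j)) => // yz; rewrite (le_trans yb (ltW yz)).
  by rewrite lef_pV2 ?posrE// (lt_le_trans N0 h).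
by rewrite ler_pdivrMr.
Qed.

(** Here [t] stands for a log-distance in mesh widths. The levels start at 2 because the upper bound
    on survival starts at [y 2]. *)
Lemma log_grid_le (t : R) J :
  t <= J.+2%:R -> t <= 2 + \sum_(j < J) (j.+2%:R < t)%R%:R.
Proof.
elim: J => [|J IH]; first by rewrite big_ord0 addr0.
rewrite big_ord_recr/= => tJ; case: ltP => /= Jt; last by rewrite addr0; exact: IH.
rewrite (le_trans tJ)// (eq_bigr (fun=> 1)); last first.
  by move=> i _; rewrite (lt_trans _ Jt)// ltr_nat !ltnS.
rewrite sumr_const card_ord -addn3 natrD; lra.
Qed.

(** The levels start at 3; the offset 2 on the right absorbs a threshold as large as [y 2]. *)
Lemma log_grid_ge (t : R) J :
  \sum_(j < J) (j.+3%:R < t)%R%:R <= Num.max (t - 2) 0.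
Proof.
elim: J => [|J IH]; first by rewrite big_ord0 le_max lexx orbT.
rewrite big_ord_recr/=; case: (ltP J.+3%:R t) => /= Jt; last by rewrite addr0.
rewrite le_max; apply/orP; left; rewrite (eq_bigr (fun=> 1)); last first.
  by move=> i _; rewrite (lt_trans _ Jt)// ltr_nat !ltnS.
rewrite sumr_const card_ord; move: Jt; rewrite -addn3 natrD; lra.
Qed.

Section grid.
Variables (y0 h c c' U : R) (J L : nat).
Hypotheses (y0_gt0 : 0 < y0) (h_gt0 : 0 < h) (c_gt0 : 0 < c) (c'_lt1 : c' < 1).
Let y (i : nat) := y0 * expR (h * i%:R).
Hypotheses (U_ge : y 0 <= U) (U_le : U <= y 2).
Hypothesis exceed_gt0 : forall i, (i <= J.+2)%N -> 0 < exceedances (y i).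
Hypothesis uncens_ge : forall i, (i < J.+2)%N ->
  c * exceedances (y i) <= uncensored_in (y i) (y i.+1).
Hypothesis uncens_le : forall i, (i < J.+2)%N ->
  uncensored_in (y i) (y i.+1) <= c' * exceedances (y i.+1).

Let y_gt0 i : 0 < y i. Proof. by rewrite mulr_gt0// expR_gt0. Qed.

Let y_le i j : (i <= j)%N -> y i <= y j.
Proof. by move=> ij; rewrite ler_pM2l// ler_expR ler_pM2l// ler_nat. Qed.

Let U_gt0 : 0 < U. Proof. exact: lt_le_trans U_ge. Qed.

Let S x := \prod_(w <- observations | U < w <= x) (1 - hazard w).

(** Each block past [y 2] lies entirely beyond the threshold and multiplies the survival function by
    at most [(1 + c)^-1]. *)
Let S_upper j : (j <= J)%N -> S (y j.+2) <= (1 + c)^-1 ^+ j.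
Proof.
elim: j => [_|j IH jJ]; first by rewrite expr0 prod1B_le1// => x; exact: hazard01.
rewrite /S (@prod_oc_split _ _ _ U (y j.+2)); last 2 first.
- by rewrite (le_trans U_le)// y_le.
- exact: y_le.
rewrite exprSr ler_pM ?prod1B_ge0//; try by move=> x; exact: hazard01.
  by apply: IH; exact: ltnW.
by apply: product_block_le; [exact: ltW|apply: exceed_gt0|apply: uncens_ge];
  rewrite ?ltnS ?(leq_trans (ltnW jJ))//.
Qed.

(** Starting the product at [y 0 <= U] only adds factors at most 1. If [y j < U], the product from
    [U] is empty and equals 1. *)
Let S_lower j : (j <= J.+2)%N -> (1 - c') ^+ j <= S (y j).
Proof.
move=> jJ; apply: (@le_trans _ _
    (\prod_(w <- observations | y 0 < w <= y j) (1 - hazard w))).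
  elim: j jJ => [|j IH] jJ.
    rewrite expr0 big_pred0// => w; apply/negbTE; rewrite negb_and -leNgt -ltNge.
    by case: (leP w (y 0)).
  rewrite (@prod_oc_split _ _ _ (y 0) (y j)) ?y_le// exprSr ler_pM//.
  - by rewrite exprn_ge0// subr_ge0 ltW.
  - by rewrite subr_ge0 ltW.
  - by apply: IH; exact: ltnW.
  - by apply: product_block_ge; [exact: exceed_gt0|exact: uncens_le].
rewrite /S; have [Uj|jU] := leP U (y j).
  rewrite (@prod_oc_split _ _ _ (y 0) U (y j))//.
  rewrite ler_piMl// ?prod1B_ge0 ?prod1B_le1//; exact: hazard01.
rewrite [leRHS]big_pred0; first by apply: prod1B_le1; exact: hazard01.
by move=> w; apply/negbTE; rewrite negb_and -leNgt -ltNge; case: (leP w U) => //=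
  /(lt_trans jU).
Qed.

Let w x := \prod_(v <- observations | U < v < x) (1 - hazard v) * hazard x.

Let w_ge0 x : 0 <= w x.
Proof.
by rewrite mulr_ge0//; [apply: prod1B_ge0; exact: hazard01|case/andP: (hazard01 x)].
Qed.

(** The defect of total mass: the survival left after the last observation. *)
Let Soo := \prod_(v <- observations | U < v) (1 - hazard v).

Let mass_gt j : (2 <= j)%N ->
  \sum_(x <- observations | U < x) w x * (y j < x)%R%:R = S (y j) - Soo.
Proof.
move=> j2; rewrite -product_limit_mass_gt ?undup_uniq//; last exact: hazard01.
by rewrite (le_trans U_le)// y_le.
Qed.

Let mass_total : \sum_(x <- observations | U < x) w x = 1 - Soo.
Proof.
have -> : 1 = S U :> R.
  rewrite /S big_pred0// => v; apply/negbTE; rewrite negb_and -leNgt -ltNge.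
  by case: (leP v U).
rewrite product_limit_mass_gt ?undup_uniq//; last exact: hazard01.
by apply: eq_bigr => x ->; rewrite mulr1.
Qed.

Let Soo_ge0 : 0 <= Soo. Proof. by apply: prod1B_ge0; exact: hazard01. Qed.

Let Soo_le j : (2 <= j)%N -> Soo <= S (y j).
Proof.
move=> j2; rewrite -subr_ge0 -mass_gt//; apply: sumr_ge0 => x _.
by rewrite mulr_ge0.
Qed.

Let ln_y i x : 0 < x -> (y i < x) = (i%:R < ln (x / y0) / h).
Proof.
move=> x0; rewrite /y ltr_pdivlMr// -[in RHS]ltr_expR lnK ?posrE ?divr_gt0//.
by rewrite ltr_pdivlMr// mulrC [h * _]mulrC.
Qed.

(** The logarithm is dominated by a staircase with steps [h] on the grid, plus the constant [h * L]
    beyond [y J.+2]. Integrating the staircase against the jumps sums the survival function over the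
    grid, which is dominated by a geometric series; the far part has mass at most
    [(1 + c)^-1 ^+ J]. *)
Lemma hill_sum_le : (forall i, (i < n)%N -> z i <= y L) ->
  hill_sum U <= h * (3 + c^-1) + h * L%:R * (1 + c)^-1 ^+ J.
Proof.
move=> zL.
have bound x : x \in observations -> U < x ->
    ln (x / U) <= h * (2 + \sum_(j < J) (y j.+2 < x)%R%:R)
                  + h * L%:R * (y J.+2 < x)%R%:R.
  move=> xo Ux; have x0 := lt_trans U_gt0 Ux.
  have lt : ln (x / U) <= h * (ln (x / y0) / h).
    rewrite mulrCA divff ?gt_eqF// mulr1 ler_ln ?posrE ?divr_gt0//.
    rewrite ler_pM2l// lef_pV2 ?posrE//; apply: le_trans U_ge.
    by rewrite /y mulr0 expR0 mulr1.
  apply: le_trans lt _.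
  case: (leP x (y J.+2)) => xJ /=.
    rewrite mulr0 addr0 ler_pM2l//.
    under eq_bigr do rewrite (ln_y _ x0).
    by apply: log_grid_le; rewrite leNgt -ln_y// -leNgt.
  rewrite mulr1 -mulrDr ler_pM2l//; apply: (@le_trans _ _ L%:R).
    rewrite leNgt -ln_y// -leNgt.
    by case: (observationsP xo) => i ni ->; exact: zL.
  by rewrite lerDr addr_ge0// sumr_ge0.
rewrite /hill_sum big_seq_cond.
apply: (@le_trans _ _ (\sum_(x <- observations | (x \in observations) && (U < x))
   (h * (2 + \sum_(j < J) (y j.+2 < x)%R%:R) + h * L%:R * (y J.+2 < x)%R%:R) * w x)).
  apply: ler_sum => x /andP[xo Ux]; apply: ler_wpM2r; first exact: w_ge0.
  exact: bound.
rewrite -big_seq_cond.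
have -> : \sum_(x <- observations | U < x)
   (h * (2 + \sum_(j < J) (y j.+2 < x)%R%:R) + h * L%:R * (y J.+2 < x)%R%:R) * w x
   = h * (2 * (1 - Soo) + \sum_(j < J) (S (y j.+2) - Soo))
     + h * L%:R * (S (y J.+2) - Soo).
  under eq_bigr do rewrite mulrDl -!mulrA mulrDl mulr_suml.
  rewrite big_split/= -mulr_sumr big_split/= -mulr_sumr mass_total.
  congr (_ * (_ + _) + _).
    rewrite exchange_big/=; apply: eq_bigr => j _.
    by rewrite -mass_gt//; apply: eq_bigr => x _; rewrite mulrC.
  rewrite -!mulrA -!mulr_sumr -mass_gt//; congr (_ * (_ * _)).
  by apply: eq_bigr => x _; rewrite mulrC.
rewrite lerD//; last first.
  apply: ler_wpM2l; first by rewrite mulr_ge0// ltW.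
  by apply: le_trans _ (S_upper (leqnn J)); rewrite gerBl.
rewrite ler_pM2l//.
have q0 : (1 + c)^-1 < 1 by rewrite invf_lt1; move: c_gt0; lra.
have : \sum_(j < J) (S (y j.+2) - Soo) <= \sum_(j < J) (1 + c)^-1 ^+ j.
  by apply: ler_sum => j _; apply: le_trans _ (S_upper (ltnW (ltn_ord j)));
    rewrite gerBl.
(* The full series sums to [1 + c^-1]; with the two initial levels this makes [3 + c^-1]. *)
have -> : \sum_(j < J) (1 + c)^-1 ^+ j = (1 - (1 + c)^-1 ^+ J) * (1 + c^-1).
  have := subrX1 (1 + c)^-1 J; set s := \sum_(_ < _) _ => eq.
  have -> : 1 - (1 + c)^-1 ^+ J = (1 - (1 + c)^-1) * s.
    by rewrite -opprB eq; ring.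
  by field; rewrite !gt_eqF//=; move: c_gt0; lra.
have p0 : 0 <= (1 + c)^-1 ^+ J by rewrite exprn_ge0// invr_ge0; move: c_gt0; lra.
have c0 : 0 < c^-1 by rewrite invr_gt0.
set A := \sum_(_ < _) _; move: Soo_ge0; nra.
Qed.

(** A staircase below the logarithm, with its first step at [y 3], whence the cube. The missing mass
    [Soo] is subtracted once per level and is at most the survival bound at the end of the grid. *)
Lemma hill_sum_ge : c' != 0 ->
  h * ((1 - c') ^+ 3 * (1 - (1 - c') ^+ J) / c' - J%:R * (1 + c)^-1 ^+ J)
  <= hill_sum U.
Proof.
move=> c'0.
have bound x : U < x -> h * \sum_(j < J) (y j.+3 < x)%R%:R <= ln (x / U).
  move=> Ux; have x0 := lt_trans U_gt0 Ux.
  under eq_bigr do rewrite (ln_y _ x0).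
  apply: (le_trans (ler_wpM2l (ltW h_gt0) (log_grid_ge _ _))).
  rewrite maxr_pMr ?(ltW h_gt0)// mulr0 ge_max; apply/andP; split; last first.
    by rewrite ln_ge0// ler_pdivlMr// mul1r ltW.
  (* Since [U <= y 2], replacing [y0] by [U] in the logarithm costs at most [2 * h]. *)
  rewrite mulrBr mulrCA divff ?gt_eqF// mulr1 lerBlDr -[h * 2]expRK.
  rewrite -lnM ?posrE ?divr_gt0 ?expR_gt0//.
  rewrite ler_ln ?posrE ?mulr_gt0 ?divr_gt0 ?invr_gt0 ?expR_gt0//.
  rewrite -mulrA ler_pM2l// -[_^-1 * _]invrK lef_pV2 ?posrE ?invr_gt0//; last first.
    by rewrite mulr_gt0 ?invr_gt0 ?expR_gt0.
  by rewrite invfM invrK mulrC ler_pdivrMl ?expR_gt0// mulrC.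
apply: (@le_trans _ _ (\sum_(x <- observations | U < x)
   (h * \sum_(j < J) (y j.+3 < x)%R%:R) * w x)); last first.
  by apply: ler_sum => x Ux; apply: ler_wpM2r => //; exact: bound.
have -> : \sum_(x <- observations | U < x)
   (h * \sum_(j < J) (y j.+3 < x)%R%:R) * w x = h * \sum_(j < J) (S (y j.+3) - Soo).
  under eq_bigr do rewrite -mulrA mulr_suml.
  rewrite -mulr_sumr exchange_big/=; congr (_ * _); apply: eq_bigr => j _.
  by rewrite -mass_gt//; apply: eq_bigr => x _; rewrite mulrC.
rewrite ler_pM2l// big_split/= sumrN sumr_const card_ord -[Soo *+ J]mulr_natl.
rewrite lerB//; last first.
  by apply: ler_wpM2l => //; apply: le_trans _ (S_upper (leqnn J)); exact: Soo_le.
apply: (@le_trans _ _ (\sum_(j < J) (1 - c') ^+ j.+3)); last first.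
  by apply: ler_sum => j _; apply: S_lower; rewrite !ltnS.
under eq_bigr do rewrite -addn3 addnC exprD.
rewrite -mulr_sumr -mulrA.
rewrite le_eqVlt; apply/orP; left; apply/eqP; congr (_ * _).
by apply: (mulIf c'0); rewrite divfK//; have := subrX1 (1 - c') J; lra.
Qed.

End grid.
End sample.

(** * The estimators as finite sums *)

Section step_functions.
Context {R : realType}.
Implicit Types (f G : R -> R) (s t a v : R).

Lemma left_limit_near f s v : (\forall t \near s^'-, f t = v) -> left_limit f s = v.
Proof. exact: lim_near_cst. Qed.

Lemma near_left_lt a s : \forall t \near s^'-, (t < a) = (s <= a).
Proof.
have [sa|as_] := leP s a; near=> t.
  by rewrite (lt_le_trans _ sa)//; near: t; exact: nbhs_left_lt.
by apply/negbTE; rewrite -leNgt; near: t; exact: nbhs_left_ge.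
Unshelve. all: by end_near. Qed.

Lemma near_left_le a s : \forall t \near s^'-, (a <= t) = (a < s).
Proof.
by near=> t; rewrite leNgt [RHS]ltNge; congr negb; near: t; exact: near_left_lt.
Unshelve. all: by end_near. Qed.

Lemma near_left_le_seq (r : seq R) s :
  \forall t \near s^'-, {in r, forall a, (a <= t) = (a < s)}.
Proof.
elim: r => [|a r IH]; first exact: nearW.
near=> t => b; rewrite inE => /predU1P[->|].
  by near: t; exact: near_left_le.
by move: b; near: t; exact: IH.
Unshelve. all: by end_near. Qed.

(** For a positive scale the left limit turns the strict inequality into a weak one, which is why
    the risk set contains the ties. *)
Lemma near_left_scale (n : nat) (z : nat -> R) (U s : R) : 0 < U ->
  \forall t \near s^'-, forall i : 'I_n, (U * t < z i) = (U * s <= z i).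
Proof.
move=> U0; apply: filter_forall => i; near=> t.
rewrite mulrC [U * s]mulrC -ltr_pdivlMr// -ler_pdivlMr//.
by near: t; exact: near_left_lt.
Unshelve. all: by end_near. Qed.

(** A negative scale reverses the order, so that the strict inequality is stable on the left of [s];
    a zero scale makes it constant. *)
Lemma near_left_scale_le0 (n : nat) (z : nat -> R) (U s : R) : U <= 0 ->
  \forall t \near s^'-, forall i : 'I_n, (U * t < z i) = (U * s < z i).
Proof.
rewrite le_eqVlt => /predU1P[->|U0].
  by apply: nearW => t i; rewrite !mul0r.
apply: filter_forall => i.
have E v : (U * v < z i) = ~~ (v <= z i / U) by rewrite mulrC -ltNge ltr_ndivrMr.
have [sa|as_] := leP s (z i / U); near=> t; rewrite !E; congr negb.
  have ts : t < s by near: t; exact: nbhs_left_lt.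
  by rewrite sa (le_trans (ltW ts) sa).
rewrite [RHS]leNgt as_; apply/negbTE; rewrite -ltNge.
by near: t; exact: nbhs_left_gt.
Unshelve. all: by end_near. Qed.

End step_functions.

Section explicit_estimators.
Context {R : realType} {d : measure_display} {T : measurableType d}
  {P : probability T R} (X Y : nat -> {RV P >-> R}) (k : nat -> nat)
  (n : nat) (w : T).
Let z i := Z X Y i w.
Let e i := delta X Y i w.
Let U := order_stat X Y n (n - k n) w.
Let obs := observations z n.
Let haz := hazard z e n.

(** The strict count and its weak left limit differ by the uncensored ties at [U * s]; the function
    decreases, hence the sign. *)
Lemma jump_T1_hat s : 0 < U ->
  jump (T1_hat X Y k n w) s = - ((k n)%:R^-1 * uncensored z e n (U * s)).
Proof.
move=> U0; rewrite /jump.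
rewrite (@left_limit_near _ _ s
  ((k n)%:R^-1 * \sum_(i < n) ((U * s <= z i) && e i)%R%:R)); last first.
  near=> t; congr (_ * _); apply: eq_bigr => i _; congr (_ && _)%:R.
  by move: i; near: t; exact: (near_left_scale n z).
rewrite /T1_hat -mulrBr -mulrN; congr (_ * _); rewrite -sumrB -sumrN.
apply: eq_bigr => i _; rewrite -/(z i) -/(e i) -/U.
by case: (ltgtP (U * s) (z i)) => _; case: (e i); rewrite /= ?subrr ?oppr0 ?sub0r.
Unshelve. all: by end_near. Qed.

Lemma left_limit_T_hat s : 0 < U ->
  left_limit (T_hat X Y k n w) s = (k n)%:R^-1 * at_risk z n (U * s).
Proof.
move=> U0; apply: left_limit_near; near=> t; congr (_ * _).
apply: eq_bigr => i _; congr (nat_of_bool _)%:R.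
by move: i; near: t; exact: (near_left_scale n z).
Unshelve. all: by end_near. Qed.

Lemma hazard_notin x : x \notin obs -> haz x = 0.
Proof.
move=> xr; rewrite /haz /hazard /uncensored big1 ?mul0r// => i _.
case: eqP => //= zx; move: xr; rewrite -zx /obs mem_observations//.
Qed.

(** The support of [G] consists of rescaled observations, so the substitution [x = U * s] reduces
    big operators over a continuum to a list. *)
Lemma fsbig_observations (idx : R) (op : Monoid.com_law idx)
    (D : {pred R}) (G : R -> R) : 0 < U ->
  (forall s, D s -> U * s \notin obs -> G s = idx) ->
  \big[op/idx]_(s \in [set` D]) G s = \big[op/idx]_(x <- obs | D (x / U)) G (x / U).
Proof.
move=> U0 HG; rewrite -(@bigfs _ _ _ _ [seq x / U | x <- obs]) ?big_map//.
- rewrite map_inj_uniq ?undup_uniq//.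
  by apply: mulIf; rewrite invr_eq0 gt_eqF.
- move=> s Ds sr; apply: HG => //; apply: contra sr => sr.
  by apply/mapP; exists (U * s) => //; rewrite mulrAC divff ?mul1r ?gt_eqF.
Qed.

Let scale_in x a b : 0 < U -> (a < x / U <= b) = (U * a < x <= U * b).
Proof. by move=> U0; rewrite ltr_pdivlMr// ler_pdivrMr// mulrC [b * U]mulrC. Qed.

(** The factors [1 / k] of the two empirical tails cancel, and the sign in the definition cancels
    that of the jumps of [T1_hat]. *)
Lemma nelson_aalenE t : 0 < U -> (0 < k n)%N ->
  nelson_aalen X Y k n w t = \sum_(x <- obs | U < x <= U * t) haz x.
Proof.
move=> U0 k0; rewrite /nelson_aalen /step_integral.
transitivity (- \sum_(s \in [set` `]1, t]%R]) - haz (U * s)).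
  congr (- _); apply: eq_fsbigr => s _.
  rewrite jump_T1_hat// left_limit_T_hat// mulrN invfM invrK /haz /hazard; congr (- _).
  rewrite mulrACA mulfV ?mul1r 1?mulrC// pnatr_eq0 -lt0n//.
rewrite fsbig_observations//; last by move=> s _ /hazard_notin ->; rewrite oppr0.
rewrite sumrN opprK; apply: eq_big => x.
  by rewrite (_ : pred_of_itv _ _ = (x / U \in `]1%R, t]))// in_itv/= scale_in// mulr1.
by rewrite mulrCA divff ?mulr1// gt_eqF.
Qed.

Lemma jump_nelson_aalen s : 0 < U -> (0 < k n)%N -> 1 < s ->
  jump (nelson_aalen X Y k n w) s = haz (U * s).
Proof.
move=> U0 k0 s1; rewrite /jump.
rewrite (@left_limit_near _ _ s (\sum_(x <- obs | U < x < U * s) haz x)); last first.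
  near=> t; rewrite nelson_aalenE// big_seq_cond [RHS]big_seq_cond.
  apply: eq_bigl => x; case: (boolP (x \in obs)) => //= xo; congr (_ && _).
  rewrite ![U * _]mulrC -ler_pdivrMr// -ltr_pdivrMr//.
  have h : {in [seq x / U | x <- obs], forall a, (a <= t) = (a < s)}.
    by near: t; exact: near_left_le_seq.
  by apply: h; apply: map_f.
rewrite nelson_aalenE// (bigID (fun x => x < U * s))/= addrC.
have -> : \sum_(x <- obs | (U < x <= U * s) && (x < U * s)) haz x =
          \sum_(x <- obs | U < x < U * s) haz x.
  apply: eq_bigl => x; case: (ltP U x) => //= Ux; case: (ltP x (U * s)).
    by move=> /ltW ->.
  by rewrite andbF.
(* Only the point [U * s] remains, present once if it is an observation and of zero hazard
   otherwise. *)
rewrite addrK; have [so|so] := boolP (U * s \in obs).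
  rewrite big_mkcond (bigD1_seq (U * s)) ?undup_uniq//= lexx ltxx.
  rewrite ltr_pMr// s1/= big1 ?addr0// => x xs; rewrite -leNgt -andbA -eq_le.
  by rewrite (negPf xs) andbF.
rewrite hazard_notin// big1_seq// => x /andP[/andP[/andP[_ xs]]].
rewrite -leNgt => sx xo; move: so; rewrite (_ : U * s = x) ?xo//.
by apply/eqP; rewrite eq_le sx xs.
Unshelve. all: by end_near. Qed.

Lemma kaplan_meierE t : 0 < U -> (0 < k n)%N ->
  kaplan_meier X Y k n w t = 1 - \prod_(x <- obs | U < x <= U * t) (1 - haz x).
Proof.
move=> U0 k0; rewrite /kaplan_meier /step_product_integral; congr (1 - _).
transitivity (\big[*%R/1]_(s \in [set` `]1, t]%R]) (1 - haz (U * s))).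
  apply: eq_fsbigr => s; rewrite inE/= in_itv/= => /andP[s1 _].
  by rewrite jump_nelson_aalen.
rewrite fsbig_observations//; last by move=> s _ /hazard_notin ->; rewrite subr0.
apply: eq_big => x.
  by rewrite (_ : pred_of_itv _ _ = (x / U \in `]1%R, t]))// in_itv/= scale_in// mulr1.
by rewrite mulrCA divff ?mulr1// gt_eqF.
Qed.

(** The integration domain of the Hill estimator includes 1 while the product integral starts beyond
    1: at [s = 1] all products are empty and there is no jump, which the indicator records. *)
Lemma jump_kaplan_meier s : 0 < U -> (0 < k n)%N -> 1 <= s ->
  jump (kaplan_meier X Y k n w) s =
  (1 < s)%R%:R * (\prod_(x <- obs | U < x < U * s) (1 - haz x) * haz (U * s)).
Proof.
move=> U0 k0 s1; rewrite /jump.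
rewrite (@left_limit_near _ _ s (1 - \prod_(x <- obs | U < x < U * s) (1 - haz x)));
    last first.
  near=> t; rewrite kaplan_meierE// big_seq_cond [in RHS]big_seq_cond; congr (1 - _).
  apply: eq_bigl => x; case: (boolP (x \in obs)) => //= xo; congr (_ && _).
  rewrite ![U * _]mulrC -ler_pdivrMr// -ltr_pdivrMr//.
  have h : {in [seq x / U | x <- obs], forall a, (a <= t) = (a < s)}.
    by near: t; exact: near_left_le_seq.
  by apply: h; apply: map_f.
rewrite kaplan_meierE//; move: s1; rewrite le_eqVlt => /predU1P[<-|s1].
  rewrite ltxx mul0r mulr1 !big_pred0 ?subrr// => x; apply/negbTE/negP => /andP[].
    by move=> /lt_trans h /h; rewrite ltxx.
  by move=> /lt_le_trans h /h; rewrite ltxx.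
rewrite s1 mul1r (bigID (fun x => x < U * s))/= mulrC.
have -> : \prod_(x <- obs | (U < x <= U * s) && (x < U * s)) (1 - haz x) =
          \prod_(x <- obs | U < x < U * s) (1 - haz x).
  apply: eq_bigl => x; case: (ltP U x) => //= Ux; case: (ltP x (U * s)).
    by move=> /ltW ->.
  by rewrite andbF.
set p := \prod_(x <- obs | U < x < U * s) _.
suff -> : \prod_(x <- obs | (U < x <= U * s) && ~~ (x < U * s)) (1 - haz x) =
   1 - haz (U * s) by ring.
have [so|so] := boolP (U * s \in obs).
  rewrite big_mkcond (bigD1_seq (U * s)) ?undup_uniq//= lexx ltxx.
  rewrite ltr_pMr// s1/= big1 ?mulr1// => x xs; rewrite -leNgt -andbA -eq_le.
  by rewrite (negPf xs) andbF.
rewrite hazard_notin// subr0 big1_seq// => x /andP[/andP[/andP[_ xs]]].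
rewrite -leNgt => sx xo; move: so; rewrite (_ : U * s = x) ?xo//.
by apply/eqP; rewrite eq_le sx xs.
Unshelve. all: by end_near. Qed.

Lemma censored_hillE : 0 < U -> (0 < k n)%N ->
  censored_hill X Y k n w = hill_sum z e n U.
Proof.
move=> U0 k0; rewrite /censored_hill /step_integral.
transitivity (\sum_(s \in [set` `[1%R, +oo[%R]) (ln s * ((1 < s)%R%:R *
   (\prod_(x <- obs | U < x < U * s) (1 - haz x) * haz (U * s))))).
  apply: eq_fsbigr => s; rewrite inE/= in_itv/= andbT => s1.
  by rewrite jump_kaplan_meier.
rewrite fsbig_observations//; last first.
  by move=> s _ /hazard_notin ->; rewrite !mulr0.
rewrite /hill_sum big_mkcond [RHS]big_mkcond/=; apply: eq_bigr => x _.
rewrite (_ : pred_of_itv _ _ = (x / U \in `[1%R, +oo[))// in_itv/= andbT.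
rewrite ler_pdivlMr// ltr_pdivlMr// !mul1r.
have -> : U * (x / U) = x by rewrite mulrCA divff ?mulr1// gt_eqF.
by case: (ltgtP U x) => //= _; rewrite ?mul1r// mul0r mulr0.
Qed.

(* For a nonpositive threshold the step functions are left-continuous, so that
   they have no jumps in the sense of [jump]. *)
Lemma censored_hill_le0 : U <= 0 -> censored_hill X Y k n w = 0.
Proof.
move=> U0.
have NA t : nelson_aalen X Y k n w t = 0.
  rewrite /nelson_aalen /step_integral fsbig1 ?oppr0// => s _.
  rewrite /jump (@left_limit_near _ (T1_hat X Y k n w) s (T1_hat X Y k n w s)).
    by rewrite subrr mulr0.
  near=> t'; congr (_ * _); apply: eq_bigr => i _; congr (_ && _)%:R.
  by move: i; near: t'; exact: (near_left_scale_le0 n z).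
have KM t : kaplan_meier X Y k n w t = 0.
  rewrite /kaplan_meier /step_product_integral fsbig1 ?subrr// => s _.
  by rewrite /jump (@left_limit_near _ _ s 0) ?NA ?subrr ?subr0//; apply: nearW.
rewrite /censored_hill /step_integral fsbig1// => s _.
by rewrite /jump (@left_limit_near _ _ s 0) ?KM ?subrr ?mulr0//; apply: nearW.
Unshelve. all: by end_near. Qed.

End explicit_estimators.

(** * Measurability *)

(** The entries at most [x] form an initial segment of the sorted sample. This trades order
    statistics for counts, both for measurability and for locating the threshold. *)
Lemma order_stat_le {R : realType} {d} {T : measurableType d} {P : probability T R}
    (X Y : nat -> {RV P >-> R}) n j w x : (0 < j <= n)%N ->
  (order_stat X Y n j w <= x) =
  (j <= count (fun i => Z X Y i w <= x)%R (iota 0 n))%N.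
Proof.
move=> /andP[j0 jn]; rewrite /order_stat.
set s := [seq Z X Y i w | i <- iota 0 n].
have ss : sorted <=%R (sort <=%R s) := sort_le_sorted s.
have sz : size (sort <=%R s) = n by rewrite size_sort size_map size_iota.
have -> : count (fun i => Z X Y i w <= x)%R (iota 0 n) =
    count (<= x) (sort <=%R s) by rewrite count_sort count_map.
have [jc|cj] := leqP.
  by rewrite nth_count_le// prednK.
apply/negbTE; rewrite -ltNge nth_count_gt// sz prednK// jn andbT.
by rewrite -ltnS prednK.
Qed.

Section measurability.
Context {d : measure_display} {T : measurableType d} {R : realType}.
Implicit Types f g : T -> R.

Lemma measurable_natr_bool (b : T -> bool) :
  measurable_fun setT b -> measurable_fun setT (fun w => (b w)%:R : R).
Proof.
move=> mb; have -> : (fun w => (b w)%:R : R) = (fun w => if b w then 1 else 0).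
  by apply/funext => w; case: (b w).
exact: measurable_fun_ifT.
Qed.

Lemma measurable_funV f :
  measurable_fun setT f -> measurable_fun setT (fun w => (f w)^-1).
Proof.
move=> mf.
(* The square makes the base of the power nonnegative; where [f] vanishes both sides are 0. *)
have -> : (fun w => (f w)^-1) = (fun w => f w * (f w ^+ 2) `^ (-1)).
  apply/funext => w; rewrite powR_inv1 ?sqr_ge0//.
  have [->|f0] := eqVneq (f w) 0; first by rewrite invr0 mul0r.
  by rewrite expr2 invfM mulrA divff ?mul1r.
apply: measurable_funM => //; apply: (measurableT_comp (measurable_powR _)).
exact: measurable_funX.
Qed.

(** The index list varies with [w]. By induction on [s], the head is kept or dropped according to
    whether its value recurs in the tail, which is a measurable event. *)
Lemma measurable_big_undup (op : R -> R -> R) (idx : R) (z : nat -> T -> R)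
    (G : T -> R -> R) (s : seq nat) :
  (forall f g, measurable_fun setT f -> measurable_fun setT g ->
    measurable_fun setT (fun w => op (f w) (g w))) ->
  (forall i, measurable_fun setT (z i)) ->
  (forall i, measurable_fun setT (fun w => G w (z i w))) ->
  measurable_fun setT (fun w => \big[op/idx]_(x <- undup [seq z i w | i <- s]) G w x).
Proof.
move=> mop mz mG; elim: s => [|i s IH].
  rewrite (_ : (fun w => _) = cst idx); first exact: measurable_cst.
  by apply/funext => w; rewrite big_nil.
pose mem_tl w := z i w \in [seq z j w | j <- s].
have mmem : measurable_fun setT mem_tl.
  rewrite /mem_tl; elim: s {IH mem_tl} => [|j s IHs] /=.
    exact: measurable_cst.
  rewrite (_ : (fun w => _) = fun w => (z i w == z j w) ||
    (z i w \in [seq z j w | j <- s])); last by apply/funext => w; rewrite in_cons.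
  by apply: measurable_or => //; exact: measurable_fun_eqr.
rewrite (_ : (fun w => _) = fun w =>
    if mem_tl w then \big[op/idx]_(x <- undup [seq z j w | j <- s]) G w x
    else op (G w (z i w)) (\big[op/idx]_(x <- undup [seq z j w | j <- s]) G w x)).
  by apply: measurable_fun_ifT => //; exact: mop.
by apply/funext => w; rewrite /= -/(mem_tl w); case: ifP => //; rewrite big_cons.
Qed.

End measurability.

Section hill_measurable.
Context {d : measure_display} {T : measurableType d} {R : realType}.
Variables (z : nat -> T -> R) (e : nat -> T -> bool) (n : nat).
Hypotheses (mz : forall i, measurable_fun setT (z i)).
Hypotheses (me : forall i, measurable_fun setT (e i)).

Lemma measurable_hazard (f : T -> R) : measurable_fun setT f ->
  measurable_fun setT (fun w => hazard (z ^~ w) (e ^~ w) n (f w)).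
Proof.
move=> mf; rewrite /hazard; apply: measurable_funM.
  apply: measurable_sum => i; apply: measurable_natr_bool.
  by apply: measurable_and => //; exact: measurable_fun_eqr.
apply: measurable_funV; apply: measurable_sum => i; apply: measurable_natr_bool.
exact: measurable_fun_ler.
Qed.

Lemma measurable_hill_sum (f : T -> R) : measurable_fun setT f ->
  measurable_fun setT (fun w => hill_sum (z ^~ w) (e ^~ w) n (f w)).
Proof.
move=> mf; rewrite /hill_sum /observations.
under eq_fun do rewrite big_mkcond/=.
pose G w x := if f w < x then ln (x / f w) *
  (\prod_(y <- undup [seq z i w | i <- iota 0 n] | f w < y < x)
     (1 - hazard (z ^~ w) (e ^~ w) n y) * hazard (z ^~ w) (e ^~ w) n x) else 0.
apply: (@measurable_big_undup _ _ _ _ _ _ G) => //.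
  exact: measurable_funD.
move=> i; rewrite /G; apply: measurable_fun_ifT => //.
  exact: measurable_fun_ltr.
apply: measurable_funM.
  apply: measurableT_comp => //; apply: measurable_funM => //.
  exact: measurable_funV.
apply: measurable_funM; last exact: measurable_hazard.
under eq_fun do rewrite big_mkcond/=.
apply: (@measurable_big_undup _ _ _ _ _ _ (fun w y =>
  if f w < y < z i w then 1 - hazard (z ^~ w) (e ^~ w) n y else 1)) => //.
  exact: measurable_funM.
move=> j; apply: measurable_fun_ifT => //.
  by apply: measurable_and; exact: measurable_fun_ltr.
by apply: measurable_funB => //; exact: measurable_hazard.
Qed.

End hill_measurable.

Section censored_hill_measurable.
Context {R : realType} {d : measure_display} {T : measurableType d}
  {P : probability T R} (X Y : nat -> {RV P >-> R}).

Lemma measurable_Z i : measurable_fun setT (Z X Y i).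
Proof. exact: measurable_minr. Qed.

Lemma measurable_delta i : measurable_fun setT (delta X Y i).
Proof. exact: measurable_fun_ler. Qed.

Lemma measurable_order_stat n j : (0 < j <= n)%N ->
  measurable_fun setT (order_stat X Y n j).
Proof.
move=> jn mT; apply: (measurability _ (RGenOInfty.measurableE R)) => //.
move=> /= _ [_ [x ->] <-]; rewrite setTI.
pose below w : R := \sum_(i <- iota 0 n) (Z X Y i w <= x)%R%:R.
have -> : order_stat X Y n j @^-1` `]x, +oo[ = below @^-1` `]-oo, j%:R[.
  apply/seteqP; suff E w : (x < order_stat X Y n j w) = (below w < j%:R).
    by split => w; rewrite /= !in_itv/= andbT E.
  rewrite ltNge order_stat_le// -ltnNge /below -natr_sum ltr_nat -sum1_count.
  by rewrite big_mkcond.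
rewrite -[X in measurable X]setTI; apply: measurable_sum => //= i.
apply: measurable_natr_bool; apply: measurable_fun_ler => //; exact: measurable_Z.
Qed.

(** The sign of the threshold selects between [hill_sum] and 0, so the estimator is measurable on
    the whole space and not only where the threshold is positive. *)
Lemma measurable_censored_hill k n : (0 < k n < n)%N ->
  measurable_fun setT (censored_hill X Y k n).
Proof.
move=> /andP[k0 kn].
have mU : measurable_fun setT (order_stat X Y n (n - k n)).
  by apply: measurable_order_stat; rewrite subn_gt0 kn leq_subr.
have -> : censored_hill X Y k n = fun w => if 0 < order_stat X Y n (n - k n) w
    then hill_sum (fun i => Z X Y i w) (fun i => delta X Y i w) n
           (order_stat X Y n (n - k n) w) else 0.
  apply/funext => w; case: ltP => U0; first exact: censored_hillE.
  exact: censored_hill_le0.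
apply: measurable_fun_ifT => //; first exact: measurable_fun_ltr.
by apply: measurable_hill_sum => // i; exact: measurable_delta.
Qed.

End censored_hill_measurable.

(** * Counts of rectangles *)

Section counting.
Context {R : realType} {d : measure_display} {T : measurableType d}
  (P : probability T R).

Lemma integral_sum_indic (I : Type) (s : seq I) (E : I -> set T) :
  (forall i, measurable (E i)) ->
  (\int[P]_w (\sum_(i <- s) \1_(E i) w)%:E = \sum_(i <- s) P (E i))%E.
Proof.
move=> mE; under eq_integral do rewrite -sumEFin.
rewrite ge0_integral_sum//=; first by apply: eq_bigr => i _; rewrite integral_indic// setIT.
by move=> i; apply/measurable_EFinP; exact: measurable_indic.
Qed.

Lemma measurable_sum_indic (I : Type) (s : seq I) (E : I -> set T) :
  (forall i, measurable (E i)) ->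
  measurable_fun setT (fun w => \sum_(i <- s) \1_(E i) w : R).
Proof. by move=> mE; apply: measurable_sum => i; exact: measurable_indic. Qed.

(** Pairwise independence gives the variance [n q (1 - q)], which is at most [n q]. *)
Lemma chebyshev_count (E : nat -> set T) (q a : R) (n : nat) :
  (forall i, measurable (E i)) -> (forall i, P (E i) = q%:E) ->
  (forall i j, i != j -> P (E i `&` E j) = (q * q)%:E) -> 0 < a ->
  (P [set w | (a <= `|\sum_(i <- iota 0 n) \1_(E i) w - n%:R * q|)%R]
    <= (n%:R * q / a ^+ 2)%:E)%E.
Proof.
move=> mE PE PEE a0.
have q0 : 0 <= q by rewrite -lee_fin -(PE 0%N).
set C := fun w => \sum_(i <- iota 0 n) \1_(E i) w : R.
have mC : measurable_fun setT C by exact: measurable_sum_indic.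
set m := n%:R * q.
have m0 : 0 <= m by rewrite mulr_ge0.
set A := [set w | a <= `|C w - m|].
have mA : measurable A.
  rewrite -[A]setTI; apply: measurable_fun_ler => //.
  by apply: measurableT_comp => //; exact: measurable_funB.
have C0 w : 0 <= C w by apply: sumr_ge0.
(* This is [a ^+ 2 * \1_A <= (C - m) ^+ 2] with the cross term moved to the left, so that only
   nonnegative functions are integrated. *)
have le w : a ^+ 2 * \1_A w + 2 * m * C w <= C w ^+ 2 + m ^+ 2.
  rewrite indicE; have [wA|_] := boolP (w \in A).
    have : a ^+ 2 <= `|C w - m| ^+ 2.
      by rewrite ler_pXn2r ?nnegrE ?(ltW a0)//; move: wA; rewrite inE.
    by rewrite real_normK ?num_real// mulr1; nra.
  by rewrite mulr0; have := sqr_ge0 (C w - m); nra.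
have intC : (\int[P]_w (C w)%:E = m%:E)%E.
  rewrite integral_sum_indic//; under eq_bigr do rewrite PE.
  by rewrite sumEFin big_const_seq iter_addr_0 count_predT size_iota -mulr_natl.
(* The square is a sum over pairs: each diagonal pair contributes [q], each other pair [q ^+ 2]. *)
have intC2 : (\int[P]_w (C w ^+ 2)%:E = (m + (n%:R * n%:R - n%:R) * q ^+ 2)%:E)%E.
  have C2 w : C w ^+ 2 = \sum_(ij <- [seq (i, j) | i <- iota 0 n, j <- iota 0 n])
      \1_(E ij.1 `&` E ij.2) w.
    rewrite big_allpairs/= expr2 /C mulr_suml; apply: eq_bigr => i _.
    by rewrite mulr_sumr; apply: eq_bigr => j _; rewrite indicI.
  under eq_integral do rewrite C2.
  rewrite integral_sum_indic//; last by move=> i; exact: measurableI.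
  rewrite big_allpairs/=.
  under eq_big_seq => i ni.
    rewrite (bigD1_seq i) ?iota_uniq//= setIid PE.
    under eq_bigr => j ji do rewrite PEE 1?eq_sym//.
    rewrite sumEFin big_const_seq iter_addr_0.
    have -> : count (predC1 i) (iota 0 n) = n.-1.
      have := count_predC (pred1 i) (iota 0 n).
      rewrite size_iota count_uniq_mem ?iota_uniq// ni => /(congr1 predn) /= <-.
      by [].
    rewrite -EFinD; over.
  rewrite sumEFin big_const_seq iter_addr_0 count_predT size_iota -mulr_natl; congr EFin.
  rewrite /m; case: (n) => [|k]; first by rewrite !mul0r; ring.
  by rewrite /= -[_ *+ k]mulr_natl -natr1; ring.
have := ge0_le_integral P measurableT (f1 := fun w => (a ^+ 2 * \1_A w + 2 * m * C w)%:E)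
   (f2 := fun w => (C w ^+ 2 + m ^+ 2)%:E).
have int1 : (\int[P]_w (a ^+ 2 * \1_A w + 2 * m * C w)%:E =
    (a ^+ 2)%:E * P A + (2 * m * m)%:E)%E.
  under eq_integral do rewrite EFinD.
  rewrite ge0_integralD//=.
  - under eq_integral do rewrite EFinM.
    rewrite ge0_integralZl_EFin ?sqr_ge0//; last first.
      by apply/measurable_EFinP; exact: measurable_indic.
    rewrite integral_indic// setIT; congr (_ + _)%E.
    under eq_integral do rewrite EFinM.
    rewrite ge0_integralZl_EFin ?mulr_ge0//; first by rewrite intC.
      by move=> w _; rewrite lee_fin.
    exact/measurable_EFinP.
  - by move=> w _; rewrite lee_fin mulr_ge0// sqr_ge0.
  - apply/measurable_EFinP; apply: measurable_funM => //; exact: measurable_indic.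
  - by move=> w _; rewrite lee_fin !mulr_ge0.
  - by apply/measurable_EFinP; apply: measurable_funM.
have int2 : (\int[P]_w (C w ^+ 2 + m ^+ 2)%:E =
   (m + (n%:R * n%:R - n%:R) * q ^+ 2 + m ^+ 2)%:E)%E.
  under eq_integral do rewrite EFinD.
  rewrite ge0_integralD//=.
  - by rewrite intC2 integral_cst//= probability_setT mule1.
  - by move=> w _; rewrite lee_fin sqr_ge0.
  - by apply/measurable_EFinP; exact: measurable_funX.
  - by move=> w _; rewrite lee_fin sqr_ge0.
rewrite int1 int2 => h.
have {h} : ((a ^+ 2)%:E * P A + (2 * m * m)%:E <=
   (m + (n%:R * n%:R - n%:R) * q ^+ 2 + m ^+ 2)%:E)%E.
  apply: h.
  - move=> w _; rewrite lee_fin; apply: addr_ge0; last by rewrite !mulr_ge0.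
    by rewrite mulr_ge0 ?sqr_ge0.
  - apply/measurable_EFinP; apply: measurable_funD; apply: measurable_funM => //.
  - by apply/measurable_EFinP; apply: measurable_funD => //; exact: measurable_funX.
  - by move=> w _; rewrite lee_fin.
rewrite -(fineK (fin_num_measure P A mA)) -EFinM -EFinD !lee_fin => h.
rewrite ler_pdivlMr ?exprn_gt0//; move: h.
have : 0 <= n%:R * q ^+ 2 by rewrite mulr_ge0// sqr_ge0.
rewrite /m; nra.
Qed.

End counting.

(** * Independence of the pairs and rectangle events *)

Section rectangles.
Context {R : realType} {d : measure_display} {T : measurableType d}
  (P : probability T R) (X Y : nat -> {RV P >-> R}).
Hypothesis XY_indep : mutually_independent (XY_family X Y).

Lemma mutually_independent_seq (I : choiceType) (W : I -> {RV P >-> R})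
    (s : seq I) (B : I -> set R) : mutually_independent W -> uniq s ->
  (forall i, measurable (B i)) ->
  P (\bigcap_(i in [set` s]) (W i @^-1` B i)) =
  (\prod_(i <- s) P (W i @^-1` B i))%E.
Proof.
move=> indW us mB; have := indW [fset x in s]%fset B mB.
have -> : [set` [fset x in s]%fset] = [set` s].
  by apply/seteqP; split => x /=; rewrite inE.
by move=> ->; apply: perm_big; apply: uniq_perm => // x; rewrite inE.
Qed.

Let Q (A B : set R) i := X i @^-1` A `&` Y i @^-1` B.

Lemma measurable_rectangle A B i : measurable A -> measurable B -> measurable (Q A B i).
Proof.
move=> mA mB; apply: measurableI; rewrite -[_ @^-1` _]setTI; exact: measurable_funPT.
Qed.

Let sides (A B : set R) (j : nat + nat) := if j is inl _ then A else B.

Lemma prob_rectangle A B i : measurable A -> measurable B ->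
  P (Q A B i) = (P (X i @^-1` A) * P (Y i @^-1` B))%E.
Proof.
move=> mA mB.
have := @mutually_independent_seq _ _ [:: inl i; inr i] (sides A B) XY_indep isT.
rewrite !big_cons big_nil mule1 /= => <-; last by case.
congr (P _); apply/seteqP; split => [w [Aw Bw] j|w h].
  by rewrite /= !inE => /orP[]/eqP ->.
by split; [have := h (inl i)|have := h (inr i)]; rewrite /= !inE eqxx ?orbT; apply.
Qed.

Lemma prob_rectangleI A B i j : measurable A -> measurable B -> i != j ->
  P (Q A B i `&` Q A B j) = (P (Q A B i) * P (Q A B j))%E.
Proof.
move=> mA mB ij; rewrite !prob_rectangle//.
have us : uniq [:: inl i; inr i; inl j; inr j : nat + nat].
  by rewrite /= !inE /= !negb_or /= !andbT; apply/andP; split; apply: contra ij => /eqP[->].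
have := @mutually_independent_seq _ _ _ (sides A B) XY_indep us.
rewrite !big_cons big_nil mule1 /= !muleA => <-; last by case.
congr (P _); apply/seteqP; split => [w [[A1 B1] [A2 B2]] l|w h].
  by rewrite /= !inE => /or4P[]/eqP ->.
by split; split; [have := h (inl i)|have := h (inr i)|have := h (inl j)|have := h (inr j)];
  rewrite /= !inE eqxx ?orbT; apply.
Qed.

Lemma chebyshev_rectangle A B (pA pB a : R) n : measurable A -> measurable B ->
  (forall i, P (X i @^-1` A) = pA%:E) -> (forall i, P (Y i @^-1` B) = pB%:E) -> 0 < a ->
  (P [set w | (a <= `|\sum_(i <- iota 0 n) \1_(Q A B i) w - n%:R * (pA * pB)|)%R]
    <= (n%:R * (pA * pB) / a ^+ 2)%:E)%E.
Proof.
move=> mA mB PA PB a0.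
have PQ i : P (Q A B i) = (pA * pB)%:E by rewrite prob_rectangle// PA PB.
apply: chebyshev_count => // [i|i j ij]; first exact: measurable_rectangle.
by rewrite prob_rectangleI// !PQ.
Qed.

End rectangles.

Section distribution.
Context {R : realType} {d : measure_display} {T : measurableType d}
  (P : probability T R) (X : {RV P >-> R}) (F : R -> R).
Hypothesis XF : forall x, cdf X x = (F x)%:E.

Lemma prob_gt x : P (X @^-1` `]x, +oo[) = (1 - F x)%:E.
Proof. by rewrite EFinB -XF -ccdf_1_cdf. Qed.

Lemma prob_itv_oc a b : a <= b -> P (X @^-1` `]a, b]) = (F b - F a)%:E.
Proof.
move=> ab; rewrite EFinB -!XF -[LHS]/(distribution P X `]a, b]).
have -> : `]a, b]%classic = `]-oo, b] `\` `]-oo, a].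
  by rewrite -[RHS]setCK setCD setCitvl setUC -[LHS]setCK setCitv.
rewrite measureD ?setIidr//; first exact: subset_itvl.
by rewrite -ge0_fin_numE// fin_num_measure.
Qed.

Lemma cdf_homo : {homo F : x y / x <= y}.
Proof. by move=> x y xy; rewrite -lee_fin -!XF cdf_nondecreasing. Qed.

End distribution.

(** * Samplewise bounds from rectangle counts *)

Section censored_hill_bounds.
Context {R : realType} {d : measure_display} {T : measurableType d}
  {P : probability T R} (X Y : nat -> {RV P >-> R}) (k : nat -> nat)
  (n : nat) (w : T).
Let z i := Z X Y i w.

Lemma exceedancesE x :
  exceedances z n x = (n - count (fun i => z i <= x)%R (iota 0 n))%:R.
Proof.
rewrite /exceedances -natr_sum; congr (_%:R).
have := count_predC (fun i => z i <= x)%R (iota 0 n); rewrite size_iota => nE.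
rewrite -[X in (X - _)%N]nE addKn -sum1_count big_mkcond/=.
rewrite -(big_mkord xpredT (fun i => (x < z i)%R : nat)).
rewrite /index_iota subn0 [RHS]big_mkcond.
by apply: eq_bigr => i _; rewrite /= -ltNge; case: ltP.
Qed.

Lemma order_stat_ge_of_exceedances x : (0 < k n < n)%N -> (k n)%:R < exceedances z n x ->
  x <= order_stat X Y n (n - k n) w.
Proof.
move=> /andP[k0 kn]; rewrite exceedancesE ltr_nat => kN.
rewrite leNgt; apply/negP => /ltW; rewrite order_stat_le ?subn_gt0 ?kn ?leq_subr//.
by rewrite leqNgt => /negP; apply; rewrite ltn_subRL addnC -ltn_subRL.
Qed.

Lemma order_stat_le_of_exceedances x : (0 < k n < n)%N -> exceedances z n x <= (k n)%:R ->
  order_stat X Y n (n - k n) w <= x.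
Proof.
move=> /andP[k0 kn]; rewrite exceedancesE ler_nat => kN.
by rewrite order_stat_le ?subn_gt0 ?kn ?leq_subr// leq_subCl.
Qed.

Variables (y0 h c c' : R) (J L : nat).
Hypotheses (kn : (0 < k n < n)%N) (y0_gt0 : 0 < y0) (h_gt0 : 0 < h) (c_gt0 : 0 < c).
Hypotheses (c'_gt0 : 0 < c') (c'_lt1 : c' < 1).
Let y (i : nat) := y0 * expR (h * i%:R).
Hypothesis exceed_gt0 : forall i, (i <= J.+2)%N -> 0 < exceedances z n (y i).
Hypothesis exceed_low : (k n)%:R < exceedances z n (y 0).
Hypothesis exceed_high : exceedances z n (y 2) <= (k n)%:R.
Hypothesis lower_block : forall i, (i < J.+2)%N -> c * exceedances z n (y i) <=
  \sum_(l < n) ((y i < X l w <= y i.+1) && (y i.+1 < Y l w))%R%:R.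
Hypothesis upper_block : forall i, (i < J.+2)%N ->
  \sum_(l < n) ((y i < X l w <= y i.+1) && (y i < Y l w))%R%:R
  <= c' * exceedances z n (y i.+1).
Hypothesis z_le : forall i, (i < n)%N -> z i <= y L.

(** A pair with [X] in the block and [Y] beyond it is uncensored with [Z = X]; an uncensored [Z] in
    the block has [X] in the block and [Y] beyond its left end. The rectangle counts thus enclose
    the uncensored count of each block. *)
Lemma censored_hill_bounds :
  h * ((1 - c') ^+ 3 * (1 - (1 - c') ^+ J) / c' - J%:R * (1 + c)^-1 ^+ J)
  <= censored_hill X Y k n w <= h * (3 + c^-1) + h * L%:R * (1 + c)^-1 ^+ J.
Proof.
have U_ge := order_stat_ge_of_exceedances kn exceed_low.
have U_le := order_stat_le_of_exceedances kn exceed_high.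
have y0_gt0' : 0 < y 0 by rewrite mulr_gt0// expR_gt0.
have uncens_ge i : (i < J.+2)%N ->
    c * exceedances z n (y i) <=
    uncensored_in z (fun i => delta X Y i w) n (y i) (y i.+1).
  move=> iJ; apply: le_trans (lower_block iJ) _; apply: ler_sum => l _.
  rewrite ler_nat; case: (boolP (_ && _)) => // /andP[/andP[yX Xy] yY].
  have XY : X l w <= Y l w := ltW (le_lt_trans Xy yY).
  by rewrite /z /Z/= /delta XY min_l// yX Xy.
have uncens_le i : (i < J.+2)%N ->
    uncensored_in z (fun i => delta X Y i w) n (y i) (y i.+1) <=
    c' * exceedances z n (y i.+1).
  move=> iJ; apply: le_trans (upper_block iJ); apply: ler_sum => l _.
  rewrite ler_nat /z /Z/= /delta; case: (leP (X l w) (Y l w)) => XY; last first.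
    by rewrite andbF.
  by rewrite andbT; case: (boolP (_ < _ <= _)) => // /andP[yX Xy]; rewrite (lt_le_trans yX).
rewrite censored_hillE ?(lt_le_trans _ U_ge)//; last by case/andP: kn.
apply/andP; split.
  by apply: (@hill_sum_ge _ _ _ _ y0 h c c') => //; rewrite gt_eqF.
exact: (@hill_sum_le _ _ _ _ y0 h c _ J L).
Qed.

End censored_hill_bounds.

(** * Regular variation and the choice of constants *)

Section regular_variation.
Context {R : realType}.
Variables (F L : R -> R) (g : R).
Hypothesis L_sv : slowly_varying L.
Hypothesis F_tail : forall x, 0 < x -> 1 - F x = L x * x `^ (- g^-1).

Lemma tail_ratio_cvg rho : 0 < rho ->
  (1 - F (t * rho)) / (1 - F t) @[t --> +oo] --> rho `^ (- g^-1).
Proof.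
move=> rho0; rewrite -[X in _ --> X]mul1r.
have: L (t * rho) / L t * rho `^ (- g^-1) @[t --> +oo] --> 1 * rho `^ (- g^-1).
  by apply: cvgMl; exact: L_sv.
apply: cvg_trans; apply: near_eq_cvg; near=> t.
have t0 : 0 < t by near: t; exact: nbhs_pinfty_gt.
rewrite !F_tail ?mulr_gt0// powRM ?ltW// invfM.
have ta : t `^ (- g^-1) != 0 by rewrite gt_eqF// powR_gt0.
rewrite [RHS]mulrACA; congr (_ * _).
by rewrite mulrAC divff// mul1r.
Unshelve. all: by end_near. Qed.

(** By monotonicity only large arguments matter. There [L t] cannot vanish, since [L (t * 1) / L t]
    is close to 1 and would be 0 by the convention on division. *)
Lemma tail_gt0 : {homo F : x y / x <= y} -> (forall x, F x <= 1) ->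
  forall x, 0 < 1 - F x.
Proof.
move=> Fh F1 x; near (pinfty_nbhs R) => t.
have t0 : 0 < t by near: t; exact: nbhs_pinfty_gt.
have xt : x <= t by near: t; apply: nbhs_pinfty_ge; exact: num_real.
have Lt : L t != 0.
  have : 0 < L (t * 1) / L t by near: t; exact: (cvgr_gt _ (L_sv ltr01)).
  by apply: contraTneq => ->; rewrite invr0 mulr0 ltxx.
apply: (@lt_le_trans _ _ (1 - F t)); last by rewrite lerB// Fh.
rewrite lt_neqAle subr_ge0 F1 andbT eq_sym F_tail// mulf_neq0// gt_eqF//.
by rewrite powR_gt0.
Unshelve. all: by end_near. Qed.

End regular_variation.

(** * Choice of the mesh and of the tolerances *)

Section constants.
Context {R : realType} (FX FY LX LY : R -> R) (gX gY : R).
Hypotheses (gX_gt0 : 0 < gX) (gY_gt0 : 0 < gY).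
Hypotheses (LX_sv : slowly_varying LX) (LY_sv : slowly_varying LY).
Hypothesis FX_tail : forall x, 0 < x -> 1 - FX x = LX x * x `^ (- gX^-1).
Hypothesis FY_tail : forall x, 0 < x -> 1 - FY x = LY x * x `^ (- gY^-1).
Hypotheses (FX_lt1 : forall x, 0 < 1 - FX x) (FY_lt1 : forall x, 0 < 1 - FY x).

(* With a = expR (- h / gX) and b = expR (- h / gY), the block ratios tend to
   (1 - a) b >= (h / gX) a b and (1 - a) / (a b) <= (h / gX) / (a b); the extra
   factor expR (- h) resp. expR h leaves room for the fluctuations of the counts. *)
Definition lower_rate (h : R) := h / gX * expR (- ((gX^-1 + gY^-1 + 1) * h)).
Definition upper_rate (h : R) := h / gX * expR ((gX^-1 + gY^-1 + 1) * h).

(** As [h] decreases to 0, [upper_rate h] tends to 0, while the quotients of [h] by either rate tend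
    to [gX]. *)
Lemma mesh_choice (eps : R) : 0 < eps -> exists h, [/\ 0 < h, upper_rate h < 1,
  h * (3 + (lower_rate h)^-1) < gX + eps &
  gX - eps < h * ((1 - upper_rate h) ^+ 3 / upper_rate h)].
Proof.
move=> eps0; set s := gX^-1 + gY^-1 + 1.
have cid : h @[h --> (0 : R)^'+] --> (0 : R) by apply: cvg_at_right_filter; exact: cvg_id.
have cE (r : R) : expR (r * h) @[h --> 0^'+] --> (1 : R).
  have : expR (r * h) @[h --> 0^'+] --> expR (r * 0).
    by apply: continuous_cvg; [exact: continuous_expR|apply: cvgMr; exact: cid].
  by rewrite mulr0 expR0.
have cu : upper_rate h @[h --> 0^'+] --> (0 : R).
  have : upper_rate h @[h --> 0^'+] --> 0 * gX^-1 * 1.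
    by apply: cvgM; [apply: cvgMl; exact: cid|exact: cE].
  by rewrite !mul0r.
have c1 : h * 3 + gX * expR (s * h) @[h --> 0^'+] --> (gX : R).
  have : h * 3 + gX * expR (s * h) @[h --> 0^'+] --> 0 * 3 + gX * 1.
    by apply: cvgD; [apply: cvgMl; exact: cid|apply: cvgMr; exact: cE].
  by rewrite mul0r add0r mulr1.
have c2 : gX * expR (- s * h) * (1 - upper_rate h) ^+ 3 @[h --> 0^'+] --> (gX : R).
  have cB : 1 - upper_rate h @[h --> 0^'+] --> (1 - 0 : R).
    by apply: cvgB => //; exact: cvg_cst.
  have : gX * expR (- s * h) * ((1 - upper_rate h) * (1 - upper_rate h) *
      (1 - upper_rate h)) @[h --> 0^'+] --> gX * 1 * ((1 - 0) * (1 - 0) * (1 - 0)).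
    apply: cvgM; first by apply: cvgMr; exact: cE.
    by apply: cvgM => //; exact: cvgM.
  rewrite subr0 !mulr1; apply: cvg_trans; apply: near_eq_cvg; apply: nearW => x /=.
  by ring.
near (0 : R)^'+ => h.
have h0 : 0 < h by near: h; exact: nbhs_right_gt.
exists h; split => //.
- by near: h; apply: (cvgr_lt _ cu); exact: ltr01.
- have -> : h * (3 + (lower_rate h)^-1) = h * 3 + gX * expR (s * h).
    rewrite /lower_rate -/s expRN; field.
    by rewrite !gt_eqF ?expR_gt0.
  by near: h; apply: (cvgr_lt _ c1); rewrite ltrDl.
- have -> : h * ((1 - upper_rate h) ^+ 3 / upper_rate h) =
      gX * expR (- s * h) * (1 - upper_rate h) ^+ 3.
    set v := (1 - _) ^+ 3; rewrite /upper_rate -/s mulNr expRN; field.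
    by rewrite !gt_eqF ?expR_gt0.
  by near: h; apply: (cvgr_gt _ c2); rewrite ltrBlDr ltrDl.
Unshelve. all: by end_near. Qed.

Let GX x := 1 - FX x.
Let GY x := 1 - FY x.

(** Divided by [GX x * GY x], each bound concerns the two tail ratios, which tend to [a] and [b];
    strict inequalities between the limits persist beyond some [x0]. *)
Lemma tail_block_bounds (h : R) : 0 < h -> exists eps q q' x0,
  [/\ 0 < eps < 1, 0 < q < 1, 0 < q' < 1 - eps, 0 < x0 &
  forall x, x0 <= x ->
  [/\ q * (GX x * GY x) <= GX (x * expR h) * GY (x * expR h),
      GX (x * expR h) * GY (x * expR h) <= q' * (GX x * GY x),
      (lower_rate h * (1 + eps) + eps) * (GX x * GY x) <=
        (GX x - GX (x * expR h)) * GY (x * expR h) &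
      (GX x - GX (x * expR h)) * GY x + eps * (GX x * GY x) <=
        upper_rate h * (1 - eps) * (GX (x * expR h) * GY (x * expR h))]].
Proof.
move=> h0; set c := lower_rate h; set c' := upper_rate h.
set a := expR (- (h / gX)); set b := expR (- (h / gY)).
have a0 : 0 < a := expR_gt0 _; have b0 : 0 < b := expR_gt0 _.
have hX : 0 < h / gX by rewrite divr_gt0.
have hY : 0 < h / gY by rewrite divr_gt0.
have a1 : a < 1 by rewrite expR_lt1 oppr_lt0.
have b1 : b < 1 by rewrite expR_lt1 oppr_lt0.
have c0 : 0 < c by rewrite mulr_gt0// expR_gt0.
have c'0 : 0 < c' by rewrite mulr_gt0// expR_gt0.
have eh : expR (- h) < 1 by rewrite expR_lt1 oppr_lt0.
have cE : c = h / gX * (a * b * expR (- h)).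
  rewrite /c /lower_rate /a /b -!expRD; congr (_ * expR _); ring.
have c'E : c' * (a * b) = h / gX * expR h.
  rewrite /c' /upper_rate /a /b -mulrA -!expRD; congr (_ * expR _); ring.
(* The inequality [1 + x <= expR x] at [h / gX] gives [h / gX * a <= 1 - a]. *)
have low : c < (1 - a) * b.
  apply: (@lt_le_trans _ _ (h / gX * (a * b))).
    by rewrite cE ltr_pM2l// gtr_pMr// mulr_gt0.
  rewrite mulrA ler_pM2r//.
  have := ler_wpM2r (ltW a0) (expR_ge1Dx (h / gX)).
  have -> : expR (h / gX) * a = 1 by rewrite /a -expRD subrr expR0.
  by rewrite mulrDl mul1r; lra.
(* The same inequality at [- (h / gX)] gives [1 - a <= h / gX]. *)
have high : 1 - a < c' * (a * b).
  rewrite c'E; apply: (@le_lt_trans _ _ (h / gX)).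
    by have := expR_ge1Dx (- (h / gX)); rewrite -/a; lra.
  by rewrite ltr_pMr// expR_gt1.
have ab0 : 0 < a * b by rewrite mulr_gt0.
have ab1 : a * b < 1 by rewrite mulr_ilt1 ?ltW.
(* The three bounds are strict at 0, so they survive for a small positive [eps]. *)
have [eps [eps0 e1 e2 e3]] : exists eps, [/\ 0 < eps, a * b < 1 - eps,
    c * (1 + eps) + eps < (1 - a) * b & 1 - a + eps < c' * (1 - eps) * (a * b)].
  have ce : e @[e --> (0 : R)^'+] --> (0 : R).
    by apply: cvg_at_right_filter; exact: cvg_id.
  have c1 (r : R) : r * e @[e --> 0^'+] --> (0 : R).
    have : r * e @[e --> 0^'+] --> r * 0 by apply: cvgMr; exact: ce.
    by rewrite mulr0.
  near (0 : R)^'+ => e.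
  have h1 : 1 * e < 1 - a * b by near: e; apply: (cvgr_lt _ (c1 _)); rewrite subr_gt0.
  have h2 : (c + 1) * e < (1 - a) * b - c.
    by near: e; apply: (cvgr_lt _ (c1 _)); rewrite subr_gt0.
  have h3 : (1 + c' * (a * b)) * e < c' * (a * b) - (1 - a).
    by near: e; apply: (cvgr_lt _ (c1 _)); rewrite subr_gt0.
  exists e; split; try lra.
  by near: e; exact: nbhs_right_gt.
have rX : GX (t * expR h) / GX t @[t --> +oo] --> a.
  have := tail_ratio_cvg LX_sv FX_tail (expR_gt0 h).
  by rewrite -expRM mulrN.
have rY : GY (t * expR h) / GY t @[t --> +oo] --> b.
  have := tail_ratio_cvg LY_sv FY_tail (expR_gt0 h).
  by rewrite -expRM mulrN.
pose rx t := GX (t * expR h) / GX t; pose ry t := GY (t * expR h) / GY t.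
have cxy : rx t * ry t @[t --> +oo] --> a * b by exact: cvgM.
have c1x : 1 - rx t @[t --> +oo] --> 1 - a by apply: cvgB => //; exact: cvg_cst.
have c1xy : (1 - rx t) * ry t @[t --> +oo] --> (1 - a) * b by exact: cvgM.
have cc : c' * (1 - eps) * (rx t * ry t) - (1 - rx t) @[t --> +oo] -->
   c' * (1 - eps) * (a * b) - (1 - a) by apply: cvgB => //; exact: cvgMr.
have [x0 x00 Hx0] : exists2 x0, 0 < x0 & forall x, x0 <= x ->
   [/\ a * b / 2 <= rx x * ry x, rx x * ry x <= (a * b + 1 - eps) / 2,
       c * (1 + eps) + eps <= (1 - rx x) * ry x &
       eps <= c' * (1 - eps) * (rx x * ry x) - (1 - rx x)].
  have : \forall x \near +oo, [/\ a * b / 2 <= rx x * ry x,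
       rx x * ry x <= (a * b + 1 - eps) / 2,
       c * (1 + eps) + eps <= (1 - rx x) * ry x &
       eps <= c' * (1 - eps) * (rx x * ry x) - (1 - rx x)].
    near=> x; split; apply: ltW; near: x.
    - by apply: (cvgr_gt _ cxy); lra.
    - by apply: (cvgr_lt _ cxy); lra.
    - exact: (cvgr_gt _ c1xy).
    - by apply: (cvgr_gt _ cc); lra.
  move=> [M [_ HM]]; exists (`|M| + 1); first by rewrite ltr_pwDr.
  move=> x Mx; apply: HM; apply: lt_le_trans Mx.
  by rewrite ltr_pwDr// ler_norm.
(* [q] is half the limit [a * b] of the tail ratio of [Z]; [q'] is the midpoint between this limit
   and [1 - eps]. *)
exists eps, (a * b / 2), ((a * b + 1 - eps) / 2), x0; split => //; try lra.
move=> x /Hx0[].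
have X0 : 0 < GX x by exact: FX_lt1.
have Y0 : 0 < GY x by exact: FY_lt1.
have -> : GX (x * expR h) = rx x * GX x by rewrite divfK ?gt_eqF.
have -> : GY (x * expR h) = ry x * GY x by rewrite divfK ?gt_eqF.
move: (rx x) (ry x) => u v i1 i2 i3 i4.
have p0 : 0 < GX x * GY x by rewrite mulr_gt0.
split.
- have := ler_wpM2r (ltW p0) i1; lra.
- have := ler_wpM2r (ltW p0) i2; lra.
- have := ler_wpM2r (ltW p0) i3; lra.
- have := ler_wpM2r (ltW p0) i4; lra.
Unshelve. all: by end_near. Qed.

End constants.

(** * Union bound *)

Section union_bound.
Context {R : realType} {d : measure_display} {T : measurableType d}
  (P : probability T R).

Lemma union_bound (A : nat -> set T) (p : R) n :
  (forall i, measurable (A i)) -> (forall i, (i < n)%N -> (P (A i) <= p%:E)%E) ->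
  (P (\big[setU/set0]_(i < n) A i) <= (n%:R * p)%:E)%E.
Proof.
move=> mA pA; apply: le_trans (Boole_inequality P (fun i _ => mA i)) _.
apply: (@le_trans _ _ (\sum_(i < n) p%:E)%E); first by apply: lee_sum => i _; exact: pA.
by rewrite sumEFin lee_fin sumr_const card_ord mulr_natl.
Qed.

End union_bound.

(** * Fluctuations of the counts along the grid *)

Section deviation.
Context {R : realType} {d : measure_display} {T : measurableType d}
  (P : probability T R) (X Y : nat -> {RV P >-> R}) (FX FY : R -> R).
Hypothesis XY_indep : mutually_independent (XY_family X Y).
Hypothesis X_FX : forall i x, cdf (X i) x = (FX x)%:E.
Hypothesis Y_FY : forall i x, cdf (Y i) x = (FY x)%:E.
Let GX x := 1 - FX x.
Let GY x := 1 - FY x.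

Lemma FX_nondecreasing : {homo FX : x y / x <= y}. Proof. exact: cdf_homo (X_FX 0). Qed.
Lemma FY_nondecreasing : {homo FY : x y / x <= y}. Proof. exact: cdf_homo (Y_FY 0). Qed.

Lemma tailX_ge0 x : 0 <= GX x.
Proof. by rewrite subr_ge0 -lee_fin -(X_FX 0) cdf_le1. Qed.
Lemma tailY_ge0 x : 0 <= GY x.
Proof. by rewrite subr_ge0 -lee_fin -(Y_FY 0) cdf_le1. Qed.

Definition rectangle_count (A B : interval R) (n : nat) (w : T) : R :=
  \sum_(l < n) ((X l w \in A) && (Y l w \in B))%:R.

Lemma rectangle_count_indic A B n w : rectangle_count A B n w =
  \sum_(l <- iota 0 n) \1_(X l @^-1` [set` A] `&` Y l @^-1` [set` B]) w.
Proof.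
rewrite /rectangle_count -(big_mkord xpredT
  (fun l => ((X l w \in A) && (Y l w \in B))%:R)) /index_iota subn0.
apply: eq_bigr => l _; rewrite indicE; congr (nat_of_bool _)%:R.
by apply/andP/idP; rewrite inE.
Qed.

Lemma measurable_rectangle_count A B n :
  measurable_fun setT (rectangle_count A B n).
Proof.
rewrite (_ : rectangle_count A B n = fun w => \sum_(l <- iota 0 n)
  \1_(X l @^-1` [set` A] `&` Y l @^-1` [set` B]) w); last first.
  by apply/funext => w; exact: rectangle_count_indic.
apply: measurable_sum_indic => l.
by apply: measurable_rectangle; exact: measurable_itv.
Qed.

Lemma measurable_deviation A B n (m a : R) :
  measurable [set w | a <= `|rectangle_count A B n w - m|].
Proof.
rewrite -[X in measurable X]setTI; apply: measurable_fun_ler => //.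
apply: measurableT_comp => //; apply: measurable_funB => //.
exact: measurable_rectangle_count.
Qed.

(** Any upper bound [nu] of the mean can serve as the scale: Chebyshev's inequality gives
    [nu / (eps * nu) ^+ 2]. *)
Lemma deviation_bound A B n (pA pB nu eps : R) :
  (forall i, P (X i @^-1` [set` A]) = pA%:E) ->
  (forall i, P (Y i @^-1` [set` B]) = pB%:E) ->
  0 < nu -> n%:R * (pA * pB) <= nu -> 0 < eps ->
  (P [set w | (eps * nu <= `|rectangle_count A B n w - n%:R * (pA * pB)|)%R]
    <= ((eps ^+ 2 * nu)^-1)%:E)%E.
Proof.
move=> PA PB nu0 le_nu eps0.
under eq_set do rewrite rectangle_count_indic.
have := chebyshev_rectangle XY_indep n (measurable_itv A) (measurable_itv B)
  PA PB (mulr_gt0 eps0 nu0).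
move/le_trans; apply.
rewrite lee_fin ler_pdivrMr ?exprn_gt0 ?mulr_gt0//; apply: le_trans le_nu _.
rewrite le_eqVlt; apply/orP; left; apply/eqP.
by field; rewrite !gt_eqF.
Qed.

Lemma deviation_tail n x (nu eps : R) :
  0 < nu -> n%:R * (GX x * GY x) <= nu -> 0 < eps ->
  (P [set w | (eps * nu <= `|rectangle_count `]x, +oo[ `]x, +oo[ n w
      - n%:R * (GX x * GY x)|)%R] <= ((eps ^+ 2 * nu)^-1)%:E)%E.
Proof.
move=> nu0 le_nu eps0; apply: deviation_bound => // i.
  exact: prob_gt (X_FX i) x.
exact: prob_gt (Y_FY i) x.
Qed.

(** The rectangle lies in the quadrant beyond [x], so the scale of the tail count at [x] also serves
    here. *)
Lemma deviation_block n x y v (nu eps : R) : x <= y -> x <= v ->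
  0 < nu -> n%:R * (GX x * GY x) <= nu -> 0 < eps ->
  (P [set w | (eps * nu <= `|rectangle_count `]x, y] `]v, +oo[ n w
      - n%:R * ((GX x - GX y) * GY v)|)%R] <= ((eps ^+ 2 * nu)^-1)%:E)%E.
Proof.
move=> xy xv nu0 le_nu eps0; apply: deviation_bound => //.
- by move=> i; rewrite (prob_itv_oc (X_FX i))//; congr EFin; rewrite /GX; ring.
- by move=> i; exact: prob_gt (Y_FY i) v.
- apply: le_trans le_nu; rewrite ler_wpM2l// ler_pM ?tailY_ge0//.
  + by rewrite subr_ge0 lerB// FX_nondecreasing.
  + by rewrite gerBl tailX_ge0.
  + by rewrite lerB// FY_nondecreasing.
Qed.

Lemma prob_Z_gt i x : P [set w | x < Z X Y i w] = (GX x * GY x)%:E.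
Proof.
have -> : [set w | x < Z X Y i w] = X i @^-1` `]x, +oo[ `&` Y i @^-1` `]x, +oo[.
  apply/seteqP; split => w; rewrite /Z/= lt_min !in_itv/= !andbT.
    by move=> /andP.
  by move=> [-> ->].
rewrite prob_rectangle//; try exact: measurable_itv.
by rewrite (prob_gt (X_FX i)) (prob_gt (Y_FY i)).
Qed.

Lemma survival_Z x : 1 - FZ X Y x = GX x * GY x.
Proof.
apply: EFin_inj; rewrite -(prob_Z_gt 0) EFinB /FZ fineK; last first.
  by rewrite fin_num_measure//; exact: measurable_itv.
by rewrite -ccdf_1_cdf; congr (P _); apply/seteqP; split => w; rewrite /= in_itv/= andbT.
Qed.

Section fixed_sample.
Variables (k : nat -> nat) (n : nat) (gX gY h eps q q' x0 u : R) (J L : nat).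
Hypotheses (gX_gt0 : 0 < gX) (gY_gt0 : 0 < gY).
Hypotheses (h_gt0 : 0 < h) (eps01 : 0 < eps < 1) (q01 : 0 < q < 1).
Hypotheses (q'01 : 0 < q' < 1 - eps).
Let c := lower_rate gX gY h.
Let c' := upper_rate gX gY h.
Hypothesis c'_lt1 : c' < 1.
Hypothesis blocks : forall x, x0 <= x ->
  [/\ q * (GX x * GY x) <= GX (x * expR h) * GY (x * expR h),
      GX (x * expR h) * GY (x * expR h) <= q' * (GX x * GY x),
      (c * (1 + eps) + eps) * (GX x * GY x) <=
        (GX x - GX (x * expR h)) * GY (x * expR h) &
      (GX x - GX (x * expR h)) * GY x + eps * (GX x * GY x) <=
        c' * (1 - eps) * (GX (x * expR h) * GY (x * expR h))].
Hypothesis kn : (0 < k n < n)%N.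
Hypothesis u_exact : n%:R * (GX u * GY u) = (k n)%:R.
(** This shift makes [y 1] equal to [u], where the expected count is exactly [k n], and leaves one
    block on either side for the random threshold. *)
Let y0 := u * expR (- h).
Hypotheses (x0_gt0 : 0 < x0) (x0_le : x0 <= y0).

Let y (i : nat) := y0 * expR (h * i%:R).
Let nu i := n%:R * (GX (y i) * GY (y i)).

Let yS i : y i.+1 = y i * expR h.
Proof. by rewrite /y -mulrA -expRD -natr1 mulrDr mulr1. Qed.

Let y0E : y 0 = y0. Proof. by rewrite /y mulr0 expR0 mulr1. Qed.

Let y1E : y 1 = u.
Proof. by rewrite yS y0E /y0 -mulrA -expRD addNr expR0 mulr1. Qed.

Let y_ge i : x0 <= y i.
Proof.
apply: le_trans x0_le _; rewrite /y ler_peMr ?(le_trans (ltW x0_gt0))//.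
by rewrite -expR0 ler_expR mulr_ge0// ltW.
Qed.

Let y_le i : y i <= y i.+1.
Proof.
rewrite yS ler_peMr ?(le_trans (ltW x0_gt0))//.
by rewrite -expR0 ler_expR ltW.
Qed.

Let k_gt0 : 0 < (k n)%:R :> R. Proof. by case/andP: kn; rewrite ltr0n. Qed.

Let n_ge0 : 0 <= n%:R :> R. Proof. by []. Qed.

Let q_gt0 : 0 < q. Proof. by case/andP: q01. Qed.
Let q'_gt0 : 0 < q'. Proof. by case/andP: q'01. Qed.
Let eps_gt0 : 0 < eps. Proof. by case/andP: eps01. Qed.

Let nu_lo i : q * nu i <= nu i.+1.
Proof.
rewrite /nu yS mulrCA; apply: ler_wpM2l => //.
by case: (blocks (y_ge i)).
Qed.

Let nu_hi i : nu i.+1 <= q' * nu i.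
Proof.
rewrite /nu yS [q' * _]mulrCA; apply: ler_wpM2l => //.
by case: (blocks (y_ge i)).
Qed.

Let nu1 : nu 1 = (k n)%:R. Proof. by rewrite /nu y1E. Qed.

Let nu0_ge : (k n)%:R <= q' * nu 0. Proof. by rewrite -nu1; exact: nu_hi. Qed.

Let nu_ge i : (k n)%:R * q ^+ i <= nu i.
Proof.
elim: i => [|i IH].
  rewrite expr0 mulr1; have : 0 < q' * nu 0 by apply: lt_le_trans nu0_ge.
  rewrite pmulr_rgt0// => ?; apply: (le_trans nu0_ge).
  case/andP: q'01 => _ h1; case/andP: eps01 => h2 _.
  by rewrite ler_piMl ?(ltW _)//; lra.
by rewrite exprS mulrCA; apply: le_trans (nu_lo i); rewrite ler_pM2l.
Qed.

Let nu_gt0 i : 0 < nu i.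
Proof. by apply: lt_le_trans (nu_ge i); rewrite mulr_gt0// exprn_gt0. Qed.

Let nu_le i : nu i.+1 <= (k n)%:R * q' ^+ i.
Proof.
elim: i => [|i IH]; first by rewrite nu1 expr0 mulr1.
by rewrite exprS mulrCA; apply: le_trans (nu_hi _) _; rewrite ler_pM2l.
Qed.

(** The failures: [bad1] for the number of exceedances of [y i], [bad2] and [bad3] for the inner and
    outer rectangles of a block, [bad4] for an observation beyond [y L]. *)
Let bad1 i := [set w | eps * nu i <= `|rectangle_count `]y i, +oo[ `]y i, +oo[ n w
      - n%:R * (GX (y i) * GY (y i))|].
Let bad2 i := [set w | eps * nu i <= `|rectangle_count `]y i, y i.+1] `]y i.+1, +oo[ n w
      - n%:R * ((GX (y i) - GX (y i.+1)) * GY (y i.+1))|].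
Let bad3 i := [set w | eps * nu i <= `|rectangle_count `]y i, y i.+1] `]y i, +oo[ n w
      - n%:R * ((GX (y i) - GX (y i.+1)) * GY (y i))|].
Let bad4 (l : nat) := [set w | y L < Z X Y l w].

Let good_bounds w :
  (forall i, (i < J.+3)%N -> [/\ ~ bad1 i w, ~ bad2 i w & ~ bad3 i w]) ->
  (forall l, (l < n)%N -> ~ bad4 l w) ->
  h * ((1 - c') ^+ 3 * (1 - (1 - c') ^+ J) / c' - J%:R * (1 + c)^-1 ^+ J)
  <= censored_hill X Y k n w <= h * (3 + c^-1) + h * L%:R * (1 + c)^-1 ^+ J.
Proof.
move=> good goodL; case/andP: eps01 => _ eps1; case/andP: q'01 => _ q'1.
have c_gt0 : 0 < c by rewrite mulr_gt0 ?divr_gt0 ?expR_gt0.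
have c'_gt0 : 0 < c' by rewrite mulr_gt0 ?divr_gt0 ?expR_gt0.
pose N i := exceedances (fun i => Z X Y i w) n (y i).
have NE i : N i = rectangle_count `]y i, +oo[ `]y i, +oo[ n w.
  by apply: eq_bigr => l _; rewrite /Z/= lt_min !in_itv/= !andbT.
have Nb i : (i < J.+3)%N -> (1 - eps) * nu i < N i < (1 + eps) * nu i.
  move=> /good[/negP + _ _]; rewrite -ltNge -NE -/(nu i) ltr_norml => /andP[h1 h2].
  by apply/andP; split; lra.
apply: (@censored_hill_bounds _ _ _ _ _ _ _ _ _ y0 h c c' J L) => //.
- by rewrite -y0E (lt_le_trans x0_gt0).
- move=> i iJ; have /andP[+ _] := Nb i iJ; apply: lt_trans.
  by rewrite mulr_gt0// subr_gt0.
(* From [k n <= q' * nu 0] and [q' < 1 - eps], more than [k n] observations exceed [y 0]. *)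
- have /andP[+ _] := Nb 0%N isT; apply: le_lt_trans; apply: (le_trans nu0_ge).
  by rewrite ler_pM2r// ltW.
(* Here [(1 + eps) * q' <= 1] because [q' < 1 - eps], so at most [k n] observations exceed [y 2]. *)
- have /andP[_ /ltW +] := Nb 2%N isT; move/le_trans; apply.
  have := nu_hi 1; rewrite nu1 => h2.
  apply: (@le_trans _ _ ((1 + eps) * (q' * (k n)%:R))).
    by rewrite ler_pM2l// addr_gt0.
  rewrite mulrA ger_pMl//; have := eps_gt0; have := q'_gt0; nra.
(* In [blocks], the summand [eps] pays for the deviation of the rectangle count and the factor
   [1 + eps] for that of [N i]. *)
- move=> i iJ; have /andP[_ Ni] := Nb i (ltnW iJ).
  have [_ /negP + _] := good i (ltnW iJ); rewrite -ltNge ltr_norml => /andP[h1 _].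
  have [_ _ h2 _] := blocks (y_ge i); rewrite -yS in h2.
  have := ler_wpM2l n_ge0 h2.
  have : c * N i <= c * ((1 + eps) * nu i) by rewrite ler_pM2l// ltW.
  rewrite (_ : \sum_(l < n) _ = rectangle_count `]y i, y i.+1] `]y i.+1, +oo[ n w).
    by move: h1; rewrite /nu -/(N i); lra.
  by apply: eq_bigr => l _; rewrite !in_itv/= andbT.
- move=> i iJ; have /andP[Ni _] := Nb i.+1 iJ.
  have [_ _ /negP +] := good i (ltnW iJ); rewrite -ltNge ltr_norml => /andP[_ h1].
  have [_ _ _ h2] := blocks (y_ge i); rewrite -yS in h2.
  have := ler_wpM2l n_ge0 h2.
  have : c' * ((1 - eps) * nu i.+1) <= c' * N i.+1 by rewrite ler_pM2l// ltW.
  rewrite (_ : \sum_(l < n) _ = rectangle_count `]y i, y i.+1] `]y i, +oo[ n w).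
    by move: h1; rewrite /nu -/(N i.+1); lra.
  by apply: eq_bigr => l _; rewrite !in_itv/= andbT.
- by move=> i /goodL/negP; rewrite -leNgt.
Qed.

Let bad_event := \big[setU/set0]_(i < J.+3) bad1 i `|`
  \big[setU/set0]_(i < J.+3) bad2 i `|` \big[setU/set0]_(i < J.+3) bad3 i `|`
  \big[setU/set0]_(l < n) bad4 l.

(** Union bound over the bad events. The three families are controlled at the scales [nu i], all at
    least [k q^(J+3)]; the last term bounds [nu L], the expected number of observations beyond
    [y L]. *)
Lemma prob_outside_bounds (E : set T) : measurable E -> (0 < L)%N ->
  (forall w, E w -> ~
    (h * ((1 - c') ^+ 3 * (1 - (1 - c') ^+ J) / c' - J%:R * (1 + c)^-1 ^+ J)
    <= censored_hill X Y k n w <= h * (3 + c^-1) + h * L%:R * (1 + c)^-1 ^+ J)) ->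
  (P E <= (3 * (J.+3%:R / (eps ^+ 2 * ((k n)%:R * q ^+ J.+3)))
           + (k n)%:R * q' ^+ L.-1)%:E)%E.
Proof.
move=> mE L0 HE.
have m1 i : measurable (bad1 i) by exact: measurable_deviation.
have m2 i : measurable (bad2 i) by exact: measurable_deviation.
have m3 i : measurable (bad3 i) by exact: measurable_deviation.
have m4 l : measurable (bad4 l).
  rewrite -[X in measurable X]setTI; apply: measurable_fun_ltr;
    [exact: measurable_cst|exact: measurable_Z|by []|by []].
have mU (A : nat -> set T) m : (forall i, measurable (A i)) ->
    measurable (\big[setU/set0]_(i < m) A i).
  by move=> mA; apply: bigsetU_measurable.
have sub : E `<=` bad_event.
  move=> w /HE nb; apply: contrapT; rewrite /bad_event => nbad; apply: nb.
  apply: good_bounds; last first.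
    by move=> l ln b; apply: nbad; right; rewrite -bigcup_mkord; exists l.
  move=> i iJ; split=> b; apply: nbad; left; [left; left|left; right|right];
    by rewrite -bigcup_mkord; exists i.
have mbad : measurable bad_event by do !apply: measurableU; exact: mU.
apply: (le_trans (le_measure P (mem_set mE) (mem_set mbad) sub)).
have p_ge (A : nat -> set T) : (forall i, measurable (A i)) ->
    (forall i, P (A i) <= ((eps ^+ 2 * nu i)^-1)%:E)%E ->
    (P (\big[setU/set0]_(i < J.+3) A i) <=
      (J.+3%:R / (eps ^+ 2 * ((k n)%:R * q ^+ J.+3)))%:E)%E.
  move=> mA pA; apply: union_bound => // i iJ; apply: (le_trans (pA i)).
  have e2 : 0 < eps ^+ 2 by rewrite exprn_gt0.
  have kq : 0 < (k n)%:R * q ^+ J.+3 by rewrite mulr_gt0// exprn_gt0.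
  have e2nu : 0 < eps ^+ 2 * nu i by apply: mulr_gt0.
  have e2kq : 0 < eps ^+ 2 * ((k n)%:R * q ^+ J.+3) by apply: mulr_gt0.
  rewrite lee_fin lef_pV2 ?posrE// ler_pM2l//; apply: le_trans (nu_ge i).
  case/andP: q01 => q0 q1; rewrite ler_pM2l//.
  by apply: ler_wiXn2l; rewrite ?(ltW q0) ?(ltW q1)// ltnW.
have p1 : (P (\big[setU/set0]_(i < J.+3) bad1 i) <=
    (J.+3%:R / (eps ^+ 2 * ((k n)%:R * q ^+ J.+3)))%:E)%E.
  by apply: p_ge => // i; exact: deviation_tail.
have p2 : (P (\big[setU/set0]_(i < J.+3) bad2 i) <=
    (J.+3%:R / (eps ^+ 2 * ((k n)%:R * q ^+ J.+3)))%:E)%E.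
  by apply: p_ge => // i; apply: deviation_block.
have p3 : (P (\big[setU/set0]_(i < J.+3) bad3 i) <=
    (J.+3%:R / (eps ^+ 2 * ((k n)%:R * q ^+ J.+3)))%:E)%E.
  by apply: p_ge => // i; apply: deviation_block.
have p4 : (P (\big[setU/set0]_(l < n) bad4 l) <= ((k n)%:R * q' ^+ L.-1)%:E)%E.
  apply: (@le_trans _ _ (nu L)%:E).
    by apply: union_bound => // l _; rewrite prob_Z_gt.
  by rewrite lee_fin -{1}(prednK L0).
have mb1 := mU _ J.+3 m1; have mb2 := mU _ J.+3 m2; have mb3 := mU _ J.+3 m3.
have mb4 := mU _ n m4.
have m12 := measurableU _ _ mb1 mb2; have m123 := measurableU _ _ m12 mb3.
apply: (le_trans (measureU2 P m123 mb4)); rewrite EFinD; apply: leeD => //.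
apply: (le_trans (measureU2 P m12 mb3)).
set t := _ / _; have -> : 3 * t = t + t + t by ring.
rewrite !EFinD; apply: leeD => //; apply: (le_trans (measureU2 P mb1 mb2)).
exact: leeD.
Qed.

End fixed_sample.
End deviation.

(** * Convergence in probability *)

Section geometric_limits.
Context {R : realType}.

(** With [s] the square root of [r], a Bernoulli-type induction keeps [n * s ^+ n] below
    [(1 - s)^-1], and the other factor [s ^+ n] tends to 0. *)
Lemma cvg_natmul_expr (r : R) : 0 < r < 1 -> n%:R * r ^+ n @[n --> \oo] --> (0 : R).
Proof.
move=> /andP[r0 r1]; pose s := Num.sqrt r.
have s0 : 0 < s by rewrite sqrtr_gt0.
have ss : s * s = r by rewrite -expr2 sqr_sqrtr// ltW.
have s1 : s < 1 by nra.
have bern n : n%:R * (1 - s) * s ^+ n + s ^+ n <= 1.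
  elim: n => [|n IH]; first by rewrite !mul0r add0r expr0.
  have sn0 : 0 < s ^+ n by rewrite exprn_gt0.
  have sn1 : s ^+ n <= 1 by rewrite exprn_ile1// ltW.
  rewrite -natr1 exprS; have := ler_wpM2l (ltW s0) IH.
  have : (1 - s) * (s * s ^+ n) <= 1 - s by rewrite ler_piMr ?subr_ge0; nra.
  lra.
have c1 : (1 - s)^-1 * s ^+ n @[n --> \oo] --> (0 : R).
  have : (1 - s)^-1 * s ^+ n @[n --> \oo] --> (1 - s)^-1 * 0.
    by apply: cvgMr; apply: cvg_expr; rewrite ger0_norm// ltW.
  by rewrite mulr0.
apply: (squeeze_cvgr _ (cvg_cst 0) c1); apply: nearW => n.
rewrite mulr_ge0 ?exprn_ge0 ?(ltW r0)//= -ss exprMn.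
have sn0 : 0 < s ^+ n by rewrite exprn_gt0.
rewrite mulrA ler_pM2r// -[leRHS]mul1r ler_pdivlMr ?subr_gt0// mulrAC.
by have := bern n; lra.
Qed.

End geometric_limits.

Theorem theorem7 (R : realType) (d : measure_display) (T : measurableType d)
    (P : probability T R) (X Y : nat -> {RV P >-> R})
    (FX FY LX LY : R -> R) (gammaX gammaY : R) (k : nat -> nat)
    (XY_indep : mutually_independent (XY_family X Y))
    (X_FX : forall i x, cdf (X i) x = (FX x)%:E)
    (Y_FY : forall i x, cdf (Y i) x = (FY x)%:E)
    (gammaX_gt0 : 0 < gammaX) (gammaY_gt0 : 0 < gammaY)
    (LX_sv : slowly_varying LX) (LY_sv : slowly_varying LY)
    (FX_tail : forall x, 0 < x -> 1 - FX x = LX x * x `^ (- gammaX^-1))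
    (FY_tail : forall x, 0 < x -> 1 - FY x = LY x * x `^ (- gammaY^-1))
    (k_infty : k @ \oo --> \oo)
    (k_over_n : (k n)%:R / n%:R @[n --> \oo] --> (0 : R))
    (u_exact : \forall n \near \oo,
       n%:R * (1 - FZ X Y (u X Y k n)) = (k n)%:R)
    (cond1 : condition1 X Y k (gammaY / (gammaX + gammaY))
               (gammaX * gammaY / (gammaX + gammaY))) :
  cvg_in_probability P (censored_hill X Y k) (cst gammaX).
Proof.
move=> eta eta0.
have [h [h0 c'1 hi_lt lo_gt]] := mesh_choice gammaY gammaX_gt0 eta0.
have GX_gt0 : forall x, 0 < 1 - FX x.
  apply: (tail_gt0 LX_sv FX_tail (FX_nondecreasing X_FX)) => x.
  by rewrite -subr_ge0; exact: tailX_ge0 X_FX x.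
have GY_gt0 : forall x, 0 < 1 - FY x.
  apply: (tail_gt0 LY_sv FY_tail (FY_nondecreasing Y_FY)) => x.
  by rewrite -subr_ge0; exact: tailY_ge0 Y_FY x.
have [eps [q [q' [x0 [eps01 q01 q'01 x00 blocks]]]]] :=
  tail_block_bounds gammaX_gt0 gammaY_gt0 LX_sv LY_sv FX_tail FY_tail GX_gt0 GY_gt0 h0.
set c := lower_rate gammaX gammaY h in hi_lt blocks *.
set c' := upper_rate gammaX gammaY h in c'1 lo_gt blocks *.
have c0 : 0 < c by rewrite mulr_gt0 ?divr_gt0 ?expR_gt0.
have c'0 : 0 < c' by rewrite mulr_gt0 ?divr_gt0 ?expR_gt0.
have /andP[q0 q1] := q01; have /andP[eps0 eps1] := eps01; have /andP[q'0 q'1] := q'01.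
(* With [J] the base-[b] logarithm of [k n], this yields [k q^J >= (b q)^J >= 2^J], which dominates
   the number of blocks. *)
have [b b1 bq] : exists2 b, (1 < b)%N & 2 <= b%:R * q.
  exists (Num.bound (2 / q)).+2 => //; rewrite -ler_pdivrMr//.
  have q2 : 0 <= 2 / q by rewrite divr_ge0// ltW.
  by apply: ltW; apply: (lt_trans (archi_boundP q2)); rewrite ltr_nat.
have b0 : 0 < b%:R :> R by rewrite ltr0n ltnW.
(* With [L = e (J + 1) + 1], this yields [k q'^(L-1) <= (b q'^e)^(J+1) <= 2^-(J+1)], while [L] stays
   linear in [J]. *)
have [e be] : exists e, b%:R * q' ^+ e <= 1 / 2.
  have : q' ^+ e @[e --> \oo] --> (0 : R).
    by apply: cvg_expr; rewrite ger0_norm ?(ltW q'0)//; lra.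
  move=> /cvgr_lt /(_ (b%:R^-1 / 2)) []; first by rewrite divr_gt0 ?invr_gt0.
  move=> e _ He; exists e; have := ler_wpM2l (ltW b0) (ltW (He e (leqnn e))).
  by have -> : b%:R * (b%:R^-1 / 2) = 1 / 2 :> R by field; rewrite gt_eqF.
pose J n := trunc_log b (k n); pose L n := (e * (J n).+1).+1.
have Joo : J @ \oo --> \oo.
  apply/cvgnyPge => A; move/cvgnyPge : k_infty => /(_ (b ^ A)%N).
  by apply: filterS => n bk; exact: trunc_log_max.
pose r := (1 + c)^-1.
have c1_gt0 : 0 < 1 + c by rewrite addr_gt0.
have r01 : 0 < r < 1 by rewrite invr_gt0 c1_gt0/= invf_lt1// ltrDl.
(* The bounds and the failure probability are made functions of [j] alone; their limits are then
   composed with [J n], which tends to infinity. *)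
pose lo j := h * ((1 - c') ^+ 3 * (1 - (1 - c') ^+ j) / c' - j%:R * r ^+ j).
pose hi j := h * (3 + c^-1) + h * (e * j.+1).+1%:R * r ^+ j.
pose bd (j : nat) : R := 3 * (j.+3%:R / (eps ^+ 2 * (2 ^+ j * q ^+ 3))) + (1 / 2) ^+ j.+1.
have rn : r ^+ j @[j --> \oo] --> (0 : R).
  by apply: cvg_expr; case/andP: r01 => ? ?; rewrite ger0_norm// ltW.
have cvg_lo : lo j @[j --> \oo] --> h * ((1 - c') ^+ 3 / c').
  have : lo j @[j --> \oo] --> h * ((1 - c') ^+ 3 * (1 - 0) / c' - 0).
    apply: cvgMr; apply: cvgB; last exact: cvg_natmul_expr.
    apply: cvgMl; apply: cvgMr; apply: cvgB; first exact: cvg_cst.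
    by apply: cvg_expr; rewrite ger0_norm; lra.
  by rewrite !subr0 mulr1.
have cvg_hi : hi j @[j --> \oo] --> h * (3 + c^-1).
  have : h * (3 + c^-1) + h * (e%:R * (j%:R * r ^+ j) + (e%:R + 1) * r ^+ j)
     @[j --> \oo] --> h * (3 + c^-1) + h * (e%:R * 0 + (e%:R + 1) * 0).
    apply: cvgD; first exact: cvg_cst.
    apply: cvgMr; apply: cvgD; last exact: cvgMr.
    by apply: cvgMr; exact: cvg_natmul_expr.
  rewrite !mulr0 addr0 mulr0 addr0; apply: cvg_trans; apply: near_eq_cvg.
  by apply: nearW => j; rewrite /hi -[(e * _).+1%:R]natr1 natrM -[j.+1%:R]natr1; ring.
have cvg_bd : bd j @[j --> \oo] --> (0 : R).
  have half01 : 0 < (1 / 2 : R) < 1 by apply/andP; split; lra.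
  have hn : (1 / 2) ^+ j @[j --> \oo] --> (0 : R).
    by apply: cvg_expr; rewrite ger0_norm; lra.
  have : 3 / (eps ^+ 2 * q ^+ 3) * (j%:R * (1 / 2) ^+ j + 3 * (1 / 2) ^+ j) +
     1 / 2 * (1 / 2) ^+ j @[j --> \oo] -->
     3 / (eps ^+ 2 * q ^+ 3) * (0 + 3 * 0) + 1 / 2 * (0 : R).
    apply: cvgD; apply: cvgMr => //; apply: cvgD; first exact: cvg_natmul_expr.
    exact: cvgMr.
  rewrite !mulr0 !addr0 mulr0; apply: cvg_trans; apply: near_eq_cvg.
  apply: nearW => j; rewrite /bd -[j.+3]addn3 natrD [(1 / 2) ^+ j.+1]exprS.
  have -> : (1 / 2) ^+ j = (2 ^+ j)^-1 :> R by rewrite expr_div_n expr1n div1r.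
  have t0 : 0 < 2 ^+ j :> R by rewrite exprn_gt0.
  by field; rewrite !gt_eqF.
(* If [u * expR (- h) < x0], then [u < M] and the survival probability of [Z] at [u] is at least
   that at [M]. It equals [k / n], which tends to 0. *)
have u_large : \forall n \near \oo, x0 <= u X Y k n * expR (- h).
  pose M := x0 * expR h.
  have kM := cvgr_lt _ k_over_n _ (mulr_gt0 (GX_gt0 M) (GY_gt0 M)).
  near=> n.
  have n0 : 0 < n%:R :> R by rewrite ltr0n; near: n; exact: nbhs_infty_gt.
  have : (k n)%:R / n%:R < (1 - FX M) * (1 - FY M) by near: n; exact: kM.
  have : n%:R * (1 - FZ X Y (u X Y k n)) = (k n)%:R by near: n; exact: u_exact.
  rewrite (survival_Z XY_indep X_FX Y_FY) => <-; rewrite mulrAC divff ?gt_eqF// mul1r.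
  rewrite expRN ler_pdivlMr ?expR_gt0// -/M; apply: contraTT; rewrite -ltNge -leNgt.
  move=> /ltW uM; rewrite ler_pM ?(ltW (GX_gt0 _)) ?(ltW (GY_gt0 _))// lerB//.
    exact: FX_nondecreasing X_FX _ _ uM.
  exact: FY_nondecreasing Y_FY _ _ uM.
have kn01 : \forall n \near \oo, (0 < k n < n)%N.
  near=> n.
  have n0 : 0 < n%:R :> R by rewrite ltr0n; near: n; exact: nbhs_infty_gt.
  apply/andP; split.
    by near: n; move/cvgnyPge : k_infty; exact.
  rewrite -(ltr_nat R) -[ltRHS]mul1r -ltr_pdivrMr//.
  by near: n; apply: (cvgr_lt _ k_over_n).
apply: (@squeeze_cvge _ _ _ _ (cst 0%E) _ (fun n => (bd (J n))%:E)); last 2 first.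
- exact: cvg_cst.
- apply: cvg_EFin; first exact: nearW.
  exact: (cvg_comp _ _ Joo cvg_bd).
near=> n; rewrite measure_ge0/=.
have kn : (0 < k n < n)%N by near: n.
have k0 : (0 < k n)%N by case/andP: kn.
have loJ : gammaX - eta < lo (J n).
  by near: n; exact: (cvgr_gt _ (cvg_comp _ _ Joo cvg_lo) _ lo_gt).
have hiJ : hi (J n) < gammaX + eta.
  by near: n; exact: (cvgr_lt _ (cvg_comp _ _ Joo cvg_hi) _ hi_lt).
have ue : n%:R * ((1 - FX (u X Y k n)) * (1 - FY (u X Y k n))) = (k n)%:R.
  by rewrite -(survival_Z XY_indep X_FX Y_FY); near: n.
have xu : x0 <= u X Y k n * expR (- h) by near: n.
have mE : measurable [set w | eta <= `|censored_hill X Y k n w - cst gammaX w|].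
  rewrite -[X in measurable X]setTI; apply: measurable_fun_ler => //.
  apply: measurableT_comp => //; apply: measurable_funB => //.
  exact: measurable_censored_hill.
apply: (le_trans (prob_outside_bounds XY_indep X_FX Y_FY gammaX_gt0 h0
  eps01 q01 q'01 c'1 blocks kn ue x00 xu (J := J n) (L := L n) mE isT _)).
  move=> w /= Ew /andP[]; rewrite -/c -/c' -/r -/(lo _) -/(hi _) => h1 h2.
  move: Ew; apply/negP; rewrite -ltNge ltr_norml; apply/andP; split; lra.
(* The lower bound on [k n] serves the Chebyshev terms, the upper bound the observations beyond the
   end of the grid. *)
have bJ : (b ^ J n)%:R <= (k n)%:R :> R by rewrite ler_nat; exact: trunc_logP.
have kb : (k n)%:R <= (b ^ (J n).+1)%:R :> R.
  by rewrite ler_nat ltnW//; exact: trunc_log_ltn.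
have kR0 : 0 < (k n)%:R :> R by rewrite ltr0n.
have e20 : 0 < eps ^+ 2 by rewrite exprn_gt0.
have qj0 j : 0 < q ^+ j by rewrite exprn_gt0.
have twoj0 j : 0 < 2 ^+ j :> R by rewrite exprn_gt0.
have pos1 : 0 < eps ^+ 2 * ((k n)%:R * q ^+ (J n).+3).
  by apply: mulr_gt0 => //; exact: mulr_gt0.
have pos2 : 0 < eps ^+ 2 * (2 ^+ J n * q ^+ 3) by apply: mulr_gt0 => //; exact: mulr_gt0.
rewrite lee_fin lerD//.
  rewrite ler_pM2l// ler_pM2l// lef_pV2// ler_pM2l//.
  rewrite -[(J n).+3]addn3 exprD mulrA ler_pM2r//.
  apply: (@le_trans _ _ ((b%:R * q) ^+ J n)); first by rewrite lerXn2r ?nnegrE; lra.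
  by rewrite exprMn ler_pM2r ?exprn_gt0// -natrX.
rewrite /L/= exprM; apply: (@le_trans _ _ ((b%:R * q' ^+ e) ^+ (J n).+1)).
  by rewrite exprMn -natrX ler_pM2r ?exprn_gt0.
by rewrite lerXn2r ?nnegrE// mulr_ge0 ?exprn_ge0 ?ltW.
Unshelve. all: by end_near. Qed.
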